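(* Let $T\in(0,\infty)$ be fixed. For all $\alpha,\beta\in\mathbb{R}$ with $\alpha\neq\beta$, the probability measures $\mathsf{P}^T_{X^{(\alpha)},T}$ and $\mathsf{P}^T_{X^{(\beta)},T}$, i.e. the laws of the processes $(X_t^{(\alpha)})_{t\in[0,T)}$ and $(X_t^{(\beta)})_{t\in[0,T)}$ on $(C[0,T),\mathcal{B}(C[0,T)))$, are singular: $\mathsf{P}^T_{X^{(\alpha)},T}\perp\mathsf{P}^T_{X^{(\beta)},T}$.
   Context: Let $(B_t)_{t\geq 0}$ be a one-dimensional standard Wiener process on a probability space $(\Omega,\mathcal{A},\mathsf{P})$ (with a filtration constructed from $B$ satisfying the usual conditions). For $\alpha\in\mathbb{R}$, $(X_t^{(\alpha)})_{t\in[0,T)}$ denotes the unique strong solution (with continuous paths) of the SDE $$\mathrm{d}X_t^{(\alpha)}=-\frac{\alpha}{T-t}X_t^{(\alpha)}\,\mathrm{d}t+\mathrm{d}B_t,\quad t\in[0,T),\qquad X_0^{(\alpha)}=0,$$ namely $X_t^{(\alpha)}=\int_0^t\left(\frac{T-t}{T-s}\right)^\alpha\mathrm{d}B_s$, $t\in[0,T)$. $C[0,T)$ is the space of continuous functions from $[0,T)$ to $\mathbb{R}$, with the topology of uniform convergence on compact subsets of $[0,T)$, and $\mathcal{B}(C[0,T))$ is its Borel $\sigma$-algebra. Two probability measures $\mathsf{P}_1,\mathsf{P}_2$ on the same measurable space are singular ($\mathsf{P}_1\perp\mathsf{P}_2$) if there are disjoint measurable sets $S_1,S_2$ with $\mathsf{P}_1(S_1)=\mathsf{P}_2(S_2)=1$.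 *)

(* Defs.v *)
From HB Require Import structures.
From mathcomp Require Import all_boot all_order all_algebra finmap.
From mathcomp Require Import all_classical all_reals all_analysis.
From mathcomp Require Import lra.

Set Implicit Arguments.
Unset Strict Implicit.
Unset Printing Implicit Defensive.

Import Order.TTheory GRing.Theory Num.Theory.
Import numFieldNormedType.Exports.

Local Open Scope classical_set_scope.
Local Open Scope ring_scope.

(* C[0,T): [`[0, T[] is coerced to the subtype carrying the subset topology.  *)
Definition path_space (R : realType) (T : R) : Type :=
  continuousType (`[0, T[%classic : set R) R.

Section path_space_structure.
Context {R : realType} (T : R).
Local Notation D := (`[0, T[%classic : set R).

HB.instance Definition _ := Choice.on (path_space T).
HB.instance Definition _ := isPointed.Build (path_space T)
  (cst 0 : continuousType D R).
(* {family compact, D -> R} carries uniform convergence on compact sets. *)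
HB.instance Definition _ := Topological.copy (path_space T)
  (initial_topology (fun f : path_space T => (f : {family compact, D -> R}))).
HB.instance Definition _ := Measurable.copy (path_space T)
  (g_sigma_algebraType (@open (path_space T))).

End path_space_structure.

(* Under the coordinate maps every element of the Borel sigma-algebra of      *)
(* C[0,T) is measurable, so that processes with continuous paths have laws.   *)
Section path_space_measurability.
Context {R : realType} (T : R).
Local Notation D := (`[0, T[%classic : set R).
Local Notation box := (rat * rat * rat * rat)%type.
Implicit Types (g h : path_space T) (b : box).

Let lt b : R := ratr b.1.1.1.
Let rt b : R := ratr b.1.1.2.
Let lv b : R := ratr b.1.2.
Let rv b : R := ratr b.2.

Let through b : set (path_space T) :=
  [set h | forall s : D, lt b < val s < rt b -> lv b <= h s <= rv b].

Let through_all (F : {fset box}) : set (path_space T) :=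
  \bigcap_(b in [set` F]) through b.

Let boxes_near g : set_system (path_space T) :=
  [set A | exists2 F, through_all F g & through_all F `<=` A].

Let boxes_near_filter g : Filter (boxes_near g).
Proof.
split.
- by exists fset0 => // b; rewrite /= inE.
- move=> A B [F Fg FA] [G Gg GB]; exists (F `|` G)%fset.
    by move=> b /=; rewrite inE => /orP[/Fg|/Gg].
  move=> h hFG; split; [apply: FA|apply: GB] => b /= bF; apply: hFG => /=;
    by rewrite inE bF ?orbT.
- by move=> A B AB [F Fg FA]; exists F => //; exact: subset_trans AB.
Qed.

Let small_box g (x : D) (e : R) : 0 < e ->
  exists b, [/\ lt b < val x < rt b, rv b - lv b < e & through b g].
Proof.
move=> e0; have e4 : 0 < e / 4 by rewrite divr_gt0.
have : nbhs x (g @^-1` ball (g x) (e / 4)).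
  by apply: (@cts_fun _ _ g x); exact: nbhsx_ballx.
rewrite -nbhs_ballE => -[d /= d0 dg].
have xd : val x - d < val x by rewrite ltrBlDr ltrDl.
have dx : val x < val x + d by rewrite ltrDl.
have [p] := rat_in_itvoo xd; rewrite in_itv /= => /andP[p1 p2].
have [q] := rat_in_itvoo dx; rewrite in_itv /= => /andP[q1 q2].
have l1 : g x - e / 2 < g x - e / 4 by lra.
have l2 : g x + e / 4 < g x + e / 2 by lra.
have [u] := rat_in_itvoo l1; rewrite in_itv /= => /andP[u1 u2].
have [v] := rat_in_itvoo l2; rewrite in_itv /= => /andP[v1 v2].
exists (p, q, u, v); rewrite /lt /rt /lv /rv /=; split.
- by rewrite p2 q1.
- lra.
move=> s; rewrite /lt /rt /lv /rv /= => /andP[s1 s2].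
have : ball (g x) (e / 4) (g s).
  apply: dg; rewrite -initial_ballE /=.
  rewrite /ball /= ltr_distlC !set_valE /=; apply/andP; split; lra.
by rewrite /ball /= ltr_distlC => /andP[? ?]; apply/andP; split; lra.
Qed.

Let boxes_near_cvg g : boxes_near g --> g.
Proof.
have FF := boxes_near_filter g.
have cvgF : {family compact,
    ((fun h : path_space T => (h : D -> R)) @ boxes_near g) --> (g : D -> R)}.
  apply/fam_cvgP => K cK P /uniform_nbhs[E [+ EP]].
  rewrite -entourage_ballE => -[e /= e0 eE].
  have : compact (val @` K).
    apply: continuous_compact cK; apply: continuous_subspaceT => x.
    exact: initial_continuous.
  rewrite compact_cover => /(_ _ [set b : box | rv b - lv b < e /\ through b g]
      (fun b => `]lt b, rt b[%classic))[|_ [x Kx <-]|F FI KF].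
  - by move=> b _; exact: interval_open.
  - have [b [xb be gb]] := small_box g x e0.
    by exists b => //=; rewrite in_itv.
  exists F => [b /= /FI|]; first by rewrite inE => -[].
  move=> h hF; apply: EP => y Ky.
  have [|b /= bF] := KF (val y); first by exists y.
  rewrite in_itv /= => yb; apply: eE; rewrite /ball /=.
  have := FI b bF; rewrite inE => -[be /(_ y yb)/andP[g1 g2]].
  have /andP[h1 h2] := hF b bF y yb.
  by rewrite ltr_distlC; apply/andP; split; lra.
move=> A; rewrite nbhsE => -[U [[V oV <-] Vg] VA].
have : nbhs (g : {family compact, D -> R}) V by exact: open_nbhs_nbhs.
by move=> /cvgF Vg'; exact: (@filterS _ _ FF _ _ VA Vg').
Qed.

Let measurable_through d (Omega : measurableType d) (X : Omega -> path_space T)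
  b : (forall t, measurable_fun setT (fun w => X w t)) ->
  measurable (X @^-1` through b).
Proof.
move=> mX.
have -> : X @^-1` through b = \bigcap_(q in [set: rat])
    [set w | forall s : D, val s = ratr q -> lt b < val s < rt b ->
       lv b <= X w s <= rv b].
  apply/seteqP; split=> [w Xw q _ s _|w Xw s /andP[ls sr]]; first exact: Xw.
  have sT : val s < T by case: s {ls sr} => s /=; rewrite inE /= in_itv /= => /andP[].
  have s0 : 0 <= val s by case: s {ls sr sT} => s /=; rewrite inE /= in_itv /= => /andP[].
  apply/negPn/negP => Xs.
  have oU : open (~` `[lv b, rv b]%classic) by apply: closed_openC; exact: interval_closed.
  have : nbhs s ((X w : D -> R) @^-1` (~` `[lv b, rv b]%classic)).
    apply: (@cts_fun _ _ (X w) s); apply: open_nbhs_nbhs; split => //=.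
    by rewrite in_itv /=; exact/negP.
  rewrite -nbhs_ballE => -[e /= e0 eX].
  pose m := Num.min (val s + e) (Num.min T (rt b)).
  have sm : val s < m by rewrite !lt_min sT sr ltrDl e0.
  have [q] := rat_in_itvoo sm; rewrite in_itv /= !lt_min.
  move=> /andP[sq /and3P[qe qT qr]].
  have qD : ratr q \in D by rewrite inE /= in_itv /= qT (le_trans s0) ?ltW.
  pose z : D := exist (fun t : R => t \in D) (ratr q) qD.
  have /= := eX z; rewrite in_itv /=; apply.
    rewrite -initial_ballE /= /ball /= ltr_distlC !set_valE /=.
    apply/andP; split => //; apply: lt_trans sq.
    by rewrite ltrBlDr ltrDl.
  by apply: (Xw q) => //=; rewrite qr (lt_trans ls).
rewrite -[X in measurable X]setCK setC_bigcap; apply: measurableC.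
apply: countable_bigcupT_measurable => // q; apply: measurableC.
have [[s [sq /andP[ls sr]]]|noq] := pselect (exists s : D,
    val s = ratr q /\ lt b < val s < rt b).
  have -> : [set w | forall s : D, val s = ratr q -> lt b < val s < rt b ->
      lv b <= X w s <= rv b] = setT `&` (fun w => X w s) @^-1` `[lv b, rv b]%classic.
    rewrite setTI; apply/seteqP; split=> w /=; rewrite in_itv /=.
      by apply => //; apply/andP.
    by move=> Xs t tq _; rewrite (_ : t = s)//; apply: val_inj; exact: etrans tq (esym sq).
  by apply: mX => //; exact: measurable_itv.
have -> : [set w | forall s : D, val s = ratr q -> lt b < val s < rt b ->
    lv b <= X w s <= rv b] = setT; last exact: measurableT.
by apply/seteqP; split => // w _ s sq sb; exfalso; apply: noq; exists s.
Qed.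

Lemma measurable_path_map d (Omega : measurableType d)
    (X : Omega -> path_space T) :
  (forall t, measurable_fun setT (fun w => X w t)) -> measurable_fun setT X.
Proof.
move=> mX; apply: (@measurability _ _ _ _ _ _ (@open (path_space T))) => //.
move=> _ [U oU <-]; rewrite setTI.
have -> : X @^-1` U = \bigcup_(F in [set: {fset box}])
    (if pselect (through_all F `<=` U) then X @^-1` through_all F else set0).
  apply/seteqP; split=> [w Uw|w [F _]]; last first.
    by case: pselect => // FU; exact: FU.
  have [F Fw FU] : boxes_near (X w) U.
    by apply: boxes_near_cvg; exact: open_nbhs_nbhs.
  by exists F => //; case: pselect.
apply: countable_bigcupT_measurable => // F; case: pselect => //= _.
rewrite /through_all preimage_bigcap.
apply: fin_bigcap_measurable => [|b _]; last exact: measurable_through.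
exact: finite_fset.
Qed.

End path_space_measurability.

Record continuous_process d (Omega : measurableType d) (R : realType) (T : R) :=
  ContinuousProcess {
    sample_path :> Omega -> path_space T;
    measurable_coordinate :
      forall t, measurable_fun setT (fun w => sample_path w t) }.

HB.instance Definition _ d (Omega : measurableType d) (R : realType) (T : R)
    (X : continuous_process Omega T) :=
  isMeasurableFun.Build _ _ _ _ (sample_path X)
    (measurable_path_map (measurable_coordinate X)).

Definition law d (Omega : measurableType d) (R : realType) (T : R)
    (P : probability Omega R) (X : continuous_process Omega T) :
    probability (path_space T) R :=
  distribution P (sample_path X).

Definition singular d (S : measurableType d) (R : realType)
    (P1 P2 : probability S R) : Prop :=
  exists S1 S2 : set S,
    [/\ measurable S1, measurable S2, S1 `&` S2 = set0,
        P1 S1 = 1%E & P2 S2 = 1%E].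

Section wiener.
Context d (Omega : measurableType d) (R : realType) (P : probability Omega R).
Implicit Type B : R -> {RV P >-> R}.

Definition natural_filtration B (t : R) : set_system Omega :=
  <<s \bigcup_(s in `[0, t]%classic)
        preimage_set_system setT (B s : Omega -> R) measurable >>.

(* The usual augmentation: adjoin the null sets, then take right limits. *)
Definition augmented_filtration B (t : R) : set_system Omega :=
  \bigcap_(u in `]t, +oo[%classic)
    <<s natural_filtration B u `|` P.-negligible >>.

(* Only the restriction of [B] to nonnegative times is constrained. *)
Record wiener_process B : Prop := WienerProcess {
  wiener_start : {ae P, forall w, B 0 w = 0};
  wiener_continuous : forall w, {within `[0, +oo[, continuous (fun t : R => B t w)};
  wiener_independent : forall s t : R, 0 <= s -> s < t ->
    forall (A : set Omega) (U : set R), natural_filtration B s A ->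
    measurable U ->
    P (A `&` [set w | U (B t w - B s w)]) =
      (P A * P [set w | U (B t w - B s w)%R])%E;
  (* [normal_prob m sigma] has standard deviation [sigma]. *)
  wiener_normal : forall s t : R, 0 <= s -> s < t ->
    forall U : set R, measurable U ->
    P [set w | U (B t w - B s w)] = normal_prob 0 (Num.sqrt (t - s)) U }.

(* Since the noise is additive, the integral form of the equation             *)
(* dX_t = - alpha / (T - t) X_t dt + dB_t involves no stochastic integral.    *)
(* ['valL_ 0] extends a path by 0 outside [0,T).                              *)
Record strong_solution B (T alpha : R) (X : continuous_process Omega T) :
    Prop := StrongSolution {
  solution_adapted : forall t, preimage_set_system setT (fun w => X w t) measurable
    `<=` augmented_filtration B (val t);
  solution_start : {ae P, forall w, 'valL_ 0 (X w) 0 = 0};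
  solution_sde : {ae P, forall w, forall t : (`[0, T[%classic : set R),
    X w t = \int[lebesgue_measure]_(s in `[0, val t])
              (- (alpha / (T - s)) * 'valL_ 0 (X w) s) + B (val t) w} }.

End wiener.

(* Main.v *)
Require Import Defs.
From HB Require Import structures.
From mathcomp Require Import all_boot all_order all_algebra.
From mathcomp Require Import all_classical all_reals all_analysis.
From mathcomp Require Import measurable_realfun ring lra.

Set Implicit Arguments.
Unset Strict Implicit.
Unset Printing Implicit Defensive.

Import Order.TTheory GRing.Theory Num.Theory.
Import numFieldNormedType.Exports.

Local Open Scope classical_set_scope.
Local Open Scope ring_scope.

(** In logarithmic time, t = T (1 - exp (- u)), the process e^(u/2) X_t is a
    time-homogeneous Ornstein-Uhlenbeck process whose drift coefficient is
    theta / 2 with theta = 1 - 2 alpha; so the task is to tell two such drifts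
    apart from one path on [0, +oo[. The observable is the bounded functional
    exp (- k e^u X_t^2 / T). Its expectation is elementary: for W normal with
    variance v, E exp (- c (y + W)^2) is again a multiple of an exponential of
    - y^2 ([integral_damp_normal]), with factor 1 / sqrt (1 + 2 c v).

    No stochastic integral is built. Along a solution, e^(alpha u) X is the
    pathwise limit of the left Riemann sums of e^(alpha u) against the
    increments of B ([variation_of_constants], [timed_cvg]): the noise is
    additive, so X - B is differentiable and the mean value theorem applies.
    For the Riemann sums, the increments of B can be integrated out one at a
    time, from the last to the first ([wiener_step], [wiener_sum]); in the limit
    this is the Markov property of X on the observables ([transition]). It gives
    the mean of one observable exactly ([mean_obs]) and bounds the correlation of
    two of them by a product ([corr_obs]), because exp (- c y^2) <= 1. In units
    of T e^(- u), the variance accumulated over a log-time h is [ou_growth theta h],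
    the integral of exp (theta r) for r in [0, h].

    If alpha > 1/2, that variance has a finite limit -1 / theta, and averages of n
    observables at spacing n concentrate at [stationary_mean theta]
    ([average_concentration]). The same averages concentrate at 0 for every
    parameter <= 1/2, since the variance is then unbounded. Hence one parameter
    above 1/2 is enough ([singular_ergodic]). If alpha < beta <= 1/2, the variances
    grow at different exponential rates, or one exponentially and one linearly,
    and a single observable at a late time, weighted at an intermediate rate, has
    mean near 0 for one process and near 1 for the other ([singular_spreading]).
    In both cases functionals of the path concentrate at two different constants,
    and Borel-Cantelli along a fast subsequence separates the laws
    ([singular_of_concentration]). *)

(** * Exponentials of squares of normal variables *)

(** The density of the measure is identified with its Radon-Nikodym derivative,
    for which the change of variables is known. *)
Lemma integral_normal_prob (R : realType) (m s : R) (f : R -> R) :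
  measurable_fun setT f -> (forall x, 0 <= f x <= 1) ->
  (\int[normal_prob m s]_x (f x)%:E =
   \int[lebesgue_measure]_x (f x * normal_pdf m s x)%:E)%E.
Proof.
move=> mf f01; have dom := @normal_prob_dominates R m s.
have mEf : measurable_fun setT (EFin \o f) by exact/measurable_EFinP.
have mp : measurable_fun setT (fun x => (normal_pdf m s x)%:E).
  by apply/measurable_EFinP; exact: measurable_normal_pdf.
under [RHS]eq_integral do rewrite EFinM.
rewrite -(Radon_Nikodym_change_of_variables dom)//=; last first.
  apply: (@le_integrable _ _ _ _ _ _ _ (cst 1%:E)) => //.
  - move=> x _ /=; have /andP[f0 f1] := f01 x.
    by rewrite lee_fin ger0_norm// normr1.
  - exact: finite_measure_integrable_cst.
apply: ae_eq_integral => //.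
- by apply: emeasurable_funM => //; apply: measurable_int; exact: Radon_Nikodym_integrable.
- exact: emeasurable_funM.
apply: ae_eqe_mul2l; apply: integral_ae_eq => //.
- exact: Radon_Nikodym_integrable.
- by move=> E _ mE; rewrite -Radon_Nikodym_integral.
Qed.

(** The Laplace transform at v of the square of a standard normal variable. *)
Definition laplace_sqr (R : realType) (v : R) : R := (Num.sqrt (1 + 2 * v))^-1.

Lemma laplace_sqr_ge0 (R : realType) (v : R) : 0 <= laplace_sqr v.
Proof. by rewrite invr_ge0 sqrtr_ge0. Qed.

(** Integrating out two independent normal increments, of variances v then w, has
    the same effect as one increment of variance w + v. *)
Lemma laplace_sqrM (R : realType) (v c w : R) : 0 <= c -> 0 <= v ->
  laplace_sqr (c * v) * laplace_sqr (c / (1 + 2 * (c * v)) * w) =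
  laplace_sqr (c * (w + v)).
Proof.
move=> c0 v0; have cv : 0 < 1 + 2 * (c * v) by rewrite ltr_pwDl// mulr_ge0// mulr_ge0.
rewrite /laplace_sqr -invfM -sqrtrM ?ltW//.
set p := (1 + _) * _; set r := 1 + _.
suff -> : p = r by [].
rewrite /p /r; field; apply: lt0r_neq0; lra.
Qed.

Definition damp (R : realType) (c x : R) : R := expR (- (c * x ^+ 2)).

Lemma damp_ge0 (R : realType) (c x : R) : 0 <= damp c x.
Proof. exact: expR_ge0. Qed.

Lemma damp_le1 (R : realType) (c x : R) : 0 <= c -> damp c x <= 1.
Proof. by move=> c0; rewrite -expR0 ler_expR oppr_le0 mulr_ge0 ?sqr_ge0. Qed.

Lemma measurable_damp (R : realType) d (S : measurableType d) (c : R)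
    (f : S -> R) :
  measurable_fun setT f -> measurable_fun setT (fun x => damp c (f x)).
Proof.
move=> mf; rewrite /damp; apply: (measurableT_comp (@measurable_expR R)).
apply: (measurableT_comp (@oppr_measurable R setT)).
by apply: measurable_funM => //; exact: measurable_funX.
Qed.

Lemma measurable_affine (R : realType) (y a : R) :
  measurable_fun setT (fun x : R => y + a * x).
Proof. by apply: measurable_funD => //; exact: mulrl_measurable. Qed.

(** Completing the square: up to a constant, the integrand times the normal density
    of variance v is the normal density of variance w = v / (1 + 2 c a^2 v) centred
    at - 2 c a y w, whose integral is 1. *)
Lemma integral_damp_normal (R : realType) (c y a v : R) : 0 <= c -> 0 < v ->
  (\int[normal_prob 0 (Num.sqrt v)]_x (damp c (y + a * x))%:E =
   (laplace_sqr (c * (a ^+ 2 * v)) *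
    damp (c / (1 + 2 * (c * (a ^+ 2 * v)))) y)%:E)%E.
Proof.
move=> c0 v0.
set q := c * (a ^+ 2 * v); have q0 : 0 <= q.
  by rewrite mulr_ge0// mulr_ge0 ?sqr_ge0// ltW.
have q1 : 0 < 1 + 2 * q by rewrite ltr_pwDl// mulr_ge0.
have s0 : Num.sqrt v != 0 by rewrite gt_eqF// sqrtr_gt0.
set w := v / (1 + 2 * q); have w0 : 0 < w by rewrite divr_gt0.
have t0 : Num.sqrt w != 0 by rewrite gt_eqF// sqrtr_gt0.
rewrite integral_normal_prob; last 2 first.
- by apply: measurable_damp; exact: measurable_affine.
- by move=> x; rewrite damp_ge0 damp_le1.
rewrite -/q; pose K := laplace_sqr q * damp (c / (1 + 2 * q)) y.
transitivity (\int[lebesgue_measure]_x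
    (K%:E * (normal_pdf (- (2 * c * a * y * w)) (Num.sqrt w) x)%:E))%E; last first.
  rewrite ge0_integralZl//=.
  - by rewrite integral_normal_pdf mule1.
  - by apply/measurable_EFinP; exact: measurable_normal_pdf.
  - by move=> x _; rewrite lee_fin normal_pdf_ge0.
  - by rewrite lee_fin mulr_ge0 ?laplace_sqr_ge0 ?damp_ge0.
apply: eq_integral => x _; rewrite -EFinM; congr EFin.
rewrite !normal_pdfE// /normal_peak /normal_fun !sqr_sqrtr ?ltW// subr0 /K.
have -> : (Num.sqrt (w * pi *+ 2))^-1 = Num.sqrt (1 + 2 * q) * (Num.sqrt (v * pi *+ 2))^-1.
  have -> : v * pi *+ 2 = (1 + 2 * q) * (w * pi *+ 2).
    rewrite /w; field; exact: lt0r_neq0.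
  by rewrite sqrtrM ?(ltW q1)// invfM mulrA divff ?mul1r// gt_eqF// sqrtr_gt0.
rewrite /laplace_sqr /damp [RHS]mulrACA [X in _ = X * _]mulrA.
rewrite mulVf ?gt_eqF ?sqrtr_gt0// mul1r mulrCA; congr (_ * _).
rewrite -!expRD; congr expR.
have {}q1 : 1 + 2 * (c * (a ^+ 2 * v)) != 0 by exact: lt0r_neq0.
have {}v0 : v != 0 by exact: lt0r_neq0.
rewrite /w /q; move: (x : R) => {}x; field.
by rewrite v0 q1.
Qed.

Section laplace_limits.
Variable R : realType.

Lemma laplace_sqr_cvg (v_ : nat -> R) (v : R) : 0 <= v ->
  v_ @ \oo --> v -> laplace_sqr (v_ n) @[n --> \oo] --> laplace_sqr v.
Proof.
move=> v0 vv; rewrite /laplace_sqr; have q0 : 0 < 1 + 2 * v.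
  by rewrite ltr_pwDl// mulr_ge0.
apply: cvgV; first by rewrite gt_eqF// sqrtr_gt0.
apply: (@cvg_comp _ _ _ (fun n => 1 + 2 * v_ n) (@Num.sqrt R) _ (nbhs (1 + 2 * v)));
  last exact: sqrt_continuous.
by apply: cvgD; [exact: cvg_cst|apply: cvgM => //; exact: cvg_cst].
Qed.

Lemma damp_cvg (c_ x_ : nat -> R) (c x : R) :
  c_ @ \oo --> c -> x_ @ \oo --> x -> damp (c_ n) (x_ n) @[n --> \oo] --> damp c x.
Proof.
move=> cc xx; rewrite /damp; apply: (@cvg_comp _ _ _ (fun n => - (c_ n * x_ n ^+ 2)) (@expR R) _
  (nbhs (- (c * x ^+ 2)))); last exact: continuous_expR.
by apply: cvgN; apply: cvgM => //; rewrite expr2; apply: cvgM.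
Qed.

Lemma laplace_sqr_le1 (v : R) : 0 <= v -> laplace_sqr v <= 1.
Proof.
move=> v0; rewrite /laplace_sqr invf_le1 ?sqrtr_gt0 ?ltr_pwDl ?mulr_ge0//.
by rewrite -[leLHS]sqrtr1 ler_sqrt ?lerDl ?mulr_ge0// addr_ge0// mulr_ge0.
Qed.

Lemma laplace_sqr_le (v w : R) : 0 <= v -> v <= w -> laplace_sqr w <= laplace_sqr v.
Proof.
move=> v0 vw; have w0 := le_trans v0 vw.
rewrite /laplace_sqr lef_pV2 ?posrE ?sqrtr_gt0 ?ltr_pwDl ?mulr_ge0//.
by rewrite ler_sqrt ?lerD2l ?ler_pM2l// addr_ge0// mulr_ge0.
Qed.

(** Dominated convergence, with the constant 1 as dominating function. *)
Lemma unit_interval_cvg d (S : measurableType d) (P : probability S R)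
    (g_ : nat -> S -> R) (g : S -> R) :
  (forall n, measurable_fun setT (g_ n)) -> measurable_fun setT g ->
  (forall n w, 0 <= g_ n w <= 1) ->
  {ae P, forall w, g_ ^~ w @ \oo --> g w} ->
  ((\int[P]_w (g_ n w)%:E) @[n --> \oo] --> \int[P]_w (g w)%:E)%E.
Proof.
move=> mg_ mg g01 gg.
have gg' : {ae P, forall w, setT w -> (g_ n w)%:E @[n --> \oo] --> (g w)%:E}.
  by apply: filterS gg => w gw _; apply: cvg_EFin => //; exact: nearW.
have le1 : {ae P, forall w n, setT w -> (`|(g_ n w)%:E| <= (EFin \o cst 1%R) w)%E}.
  apply: aeW => w n _ /=; have /andP[g0 g1] := g01 n w.
  by rewrite lee_fin ger0_norm.
have [_ _] := dominated_convergence measurableT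
  (fun n => (measurable_EFinP _ _).2 (mg_ n)) ((measurable_EFinP _ _).2 mg) gg'
  (finite_measure_integrable_cst P 1 measurableT) le1.
exact.
Qed.

End laplace_limits.

(** * Integrating out Wiener increments *)

(** Freezing lemma: independence makes the joint law of U and W a product, to
    which Tonelli's theorem applies. *)
Lemma integral_independent (R : realType) d (Omega : measurableType d)
    (P : probability Omega R) d1 d2 (S1 : measurableType d1)
    (S2 : measurableType d2) (nu : probability S2 R)
    (U : Omega -> S1) (W : Omega -> S2) (G : S1 * S2 -> \bar R) :
  measurable_fun setT U -> measurable_fun setT W ->
  (forall A V, measurable A -> measurable V ->
     P (U @^-1` A `&` W @^-1` V) = P (U @^-1` A) * nu V)%E ->
  measurable_fun setT G -> (forall z, 0 <= G z)%E ->
  (\int[P]_w G (U w, W w) = \int[P]_w \int[nu]_x G (U w, x))%E.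
Proof.
move=> mU mW indep mG G0.
pose mfU : {mfun Omega >-> S1} := HB.pack U (isMeasurableFun.Build _ _ _ _ U mU).
have mUW : measurable_fun setT (fun w => (U w, W w)) by exact: measurable_fun_pair.
pose UW : {mfun Omega >-> (S1 * S2)%type} :=
  HB.pack (fun w => (U w, W w)) (isMeasurableFun.Build _ _ _ _ _ mUW).
transitivity (\int[distribution P UW]_z G z)%E.
  by rewrite ge0_integral_distribution.
transitivity (\int[(distribution P mfU \x nu)%E]_z G z)%E.
  apply: eq_measure_integral => A mA _.
  by apply/esym/product_measure_unique => // A1 A2 mA1 mA2; exact: indep.
rewrite fubini_tonelli1// ge0_integral_distribution//.
- exact: measurable_fun_fubini_tonelli_F.
- by move=> x; apply: integral_ge0.
Qed.

Section past.
Context (R : realType) (d : measure_display) (Omega : measurableType d)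
  (P : probability Omega R) (B : R -> {RV P >-> R}).

Definition past_events (t : R) : set_system Omega :=
  \bigcup_(s in `[0, t]%classic)
    preimage_set_system setT (B s : Omega -> R) measurable.

(** Measurability for the natural filtration, phrased on a generated sigma-algebra
    so that the closure properties of measurable functions apply. *)
Definition past_measurable (t : R) (Y : Omega -> R) :=
  measurable_fun (setT : set (g_sigma_algebraType (past_events t))) Y.

Lemma natural_filtration_measurable t : natural_filtration B t `<=` measurable.
Proof.
apply: smallest_sub; first exact: sigma_algebra_measurable.
by move=> _ [s _] [V mV <-]; exact: measurable_funP.
Qed.

Lemma past_measurable_measurable t Y : past_measurable t Y -> measurable_fun setT Y.
Proof.
move=> mY _ V mV; apply: (@natural_filtration_measurable t).
exact: mY.
Qed.

Lemma past_measurable_le s t Y : s <= t -> past_measurable s Y -> past_measurable t Y.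
Proof.
move=> st mY mT V mV; have := mY measurableT V mV; apply: sub_sigma_algebra2.
move=> A [r /= r0s AB]; exists r => //=.
by move: r0s; rewrite !in_itv/= => /andP[-> /le_trans]; exact.
Qed.

Lemma past_measurable_wiener s t : 0 <= s <= t -> past_measurable t (B s).
Proof.
move=> st _ V mV; apply: sub_sigma_algebra; exists s; first by rewrite /= in_itv.
by exists V.
Qed.

(** The Markov step: conditionally on the past of s, the increment of B on [s, t] is
    an independent normal variable. The weight Z carries earlier observables. *)
Lemma wiener_step s t Y Z c a : wiener_process B -> 0 <= s -> s < t ->
  past_measurable s Y -> past_measurable s Z -> (forall w, 0 <= Z w) -> 0 <= c ->
  (\int[P]_w (Z w * damp c (Y w + a * (B t w - B s w)))%:E =
   (laplace_sqr (c * (a ^+ 2 * (t - s))))%:E *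
   \int[P]_w (Z w * damp (c / (1 + 2 * (c * (a ^+ 2 * (t - s))))) (Y w))%:E)%E.
Proof.
move=> wB s0 st pY pZ Z0 c0.
have mY := past_measurable_measurable pY; have mZ := past_measurable_measurable pZ.
pose W w := B t w - B s w.
have mW : measurable_fun setT W by exact: measurable_funB.
pose G (z : (R * R) * R) :=
  (z.1.2 * damp c (z.1.1 + a * z.2))%:E.
have mG : measurable_fun setT G.
  apply/measurable_EFinP; apply: measurable_funM.
    exact: measurableT_comp.
  apply: measurable_damp; apply: measurable_funD.
    exact: measurableT_comp.
  exact: measurable_funM.
(* Tonelli's theorem asks for nonnegativity everywhere; G is negative where its
   second argument is, and no value of Z is. *)
pose Gp (z : (R * R) * R) := maxe (G z) 0.
transitivity (\int[P]_w Gp ((Y w, Z w), W w))%E.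
  apply: eq_integral => w _; rewrite /Gp /G/= max_l// lee_fin.
  by rewrite mulr_ge0 ?damp_ge0.
rewrite (@integral_independent _ _ _ P _ _ _ _ (normal_prob 0 (Num.sqrt (t - s)))
   (fun w => (Y w, Z w)) W Gp)//; first last.
- by move=> z; rewrite le_max lexx orbT.
- exact: measurable_maxe.
- move=> A V mA mV.
  have pA : natural_filtration B s ((fun w => (Y w, Z w)) @^-1` A).
    have : measurable_fun (setT : set (g_sigma_algebraType (past_events s)))
      (fun w => (Y w, Z w)) by exact: measurable_fun_pair.
    by move=> /(_ measurableT A mA); rewrite setTI.
  have := wiener_independent wB s0 st pA mV.
  by rewrite (wiener_normal wB s0 st mV).
- exact: measurable_fun_pair.
have K0 : 0 <= 1 + 2 * (c * (a ^+ 2 * (t - s))).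
  by rewrite addr_ge0// mulr_ge0// mulr_ge0// mulr_ge0 ?sqr_ge0 ?subr_ge0 ?(ltW st).
rewrite -ge0_integralZl//; last 3 first.
- by apply/measurable_EFinP/measurable_funM => //; exact: measurable_damp.
- by move=> w _; rewrite lee_fin mulr_ge0 ?damp_ge0.
- by rewrite lee_fin laplace_sqr_ge0.
apply: eq_integral => w _; rewrite -EFinM mulrCA.
have -> : (fun x => Gp (Y w, Z w, x)) =
   (fun x => (Z w)%:E * (damp c (Y w + a * x))%:E)%E.
  apply/funext => x; rewrite /Gp /G/= max_l ?EFinM// -EFinM lee_fin.
  by rewrite mulr_ge0 ?damp_ge0.
rewrite ge0_integralZl//.
- by rewrite integral_damp_normal ?subr_gt0.
- by apply/measurable_EFinP/measurable_damp; exact: measurable_affine.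
- by move=> x _; rewrite lee_fin damp_ge0.
- by rewrite lee_fin.
Qed.

End past.

Section wiener_sums.
Context (R : realType) (d : measure_display) (Omega : measurableType d)
  (P : probability Omega R) (B : R -> {RV P >-> R}).
Hypothesis wB : wiener_process B.
Variables (p k : nat -> R).
Hypothesis p0 : 0 <= p 0%N.
Hypothesis pS : forall i, p i < p i.+1.

Let p_ge0 i : 0 <= p i.
Proof. by elim: i => // i IH; rewrite (le_trans IH)// ltW. Qed.

Lemma past_measurable_sum N Y : past_measurable B (p 0) Y ->
  past_measurable B (p N)
    (fun w => Y w + \sum_(i < N) k i * (B (p i.+1) w - B (p i) w)).
Proof.
move=> pY; elim: N => [|N IH].
  by under eq_fun do rewrite big_ord0 addr0.
under eq_fun do rewrite big_ord_recr/= addrA.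
apply: measurable_funD.
  by apply: past_measurable_le IH; exact: ltW.
apply: measurable_funM => //; apply: measurable_funB.
  by apply: past_measurable_wiener; rewrite p_ge0 lexx.
by apply: past_measurable_wiener; rewrite p_ge0 ltW.
Qed.

(** Integrating the increments out from the last one keeps the integrand in the
    form required by [wiener_step], with a smaller constant each time. *)
Lemma wiener_sum N Y Z c : past_measurable B (p 0) Y ->
  past_measurable B (p 0) Z -> (forall w, 0 <= Z w) -> 0 <= c ->
  let v := \sum_(i < N) k i ^+ 2 * (p i.+1 - p i) in
  (\int[P]_w (Z w *
     damp c (Y w + \sum_(i < N) k i * (B (p i.+1) w - B (p i) w)))%:E =
   (laplace_sqr (c * v))%:E *
   \int[P]_w (Z w * damp (c / (1 + 2 * (c * v))) (Y w))%:E)%E.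
Proof.
move=> pY pZ Z0; elim: N c => [|N IH] c c0 v.
  rewrite /v big_ord0 mulr0 mulr0 addr0 divr1 /laplace_sqr mulr0 addr0 sqrtr1.
  rewrite invr1 mul1e; apply: eq_integral => w _; rewrite big_ord0 addr0; reflexivity.
under eq_integral do rewrite big_ord_recr/= addrA.
rewrite wiener_step//; last 2 first.
- exact: past_measurable_sum.
- apply: past_measurable_le pZ.
  by elim: N {IH v} => // N IH; rewrite (le_trans IH)// ltW.
set u := k N ^+ 2 * _.
have u0 : 0 <= u by rewrite mulr_ge0 ?sqr_ge0// subr_ge0 ltW.
have cu : 0 < 1 + 2 * (c * u) by rewrite ltr_pwDl// mulr_ge0// mulr_ge0.
rewrite IH ?divr_ge0 ?(ltW cu)//.
set v' := \sum_(i < N) _.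
have v'0 : 0 <= v'.
  by apply: sumr_ge0 => i _; rewrite mulr_ge0 ?sqr_ge0// subr_ge0 ltW.
have vE : v = v' + u by rewrite /v big_ord_recr.
have cv : 0 <= c * v' by rewrite mulr_ge0.
have -> : c / (1 + 2 * (c * u)) / (1 + 2 * (c / (1 + 2 * (c * u)) * v')) =
    c / (1 + 2 * (c * v)).
  by rewrite vE; field; apply/andP; split; apply: lt0r_neq0; lra.
rewrite muleA -EFinM (laplace_sqrM v' c0 u0) -vE.
reflexivity.
Qed.

End wiener_sums.

(** * Pathwise variation of constants *)

(** The number of pieces is N.+1, so that every N gives a partition. *)
Definition mesh (R : realType) (s t : R) (N i : nat) : R :=
  s + (t - s) / N.+1%:R * i%:R.

Lemma meshS (R : realType) (s t : R) N i :
  mesh s t N i.+1 = mesh s t N i + (t - s) / N.+1%:R.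
Proof. by rewrite /mesh -[i.+1]addn1 natrD mulrDr mulr1 addrA. Qed.

Lemma mesh0 (R : realType) (s t : R) N : mesh s t N 0 = s.
Proof. by rewrite /mesh mulr0 addr0. Qed.

Lemma mesh_end (R : realType) (s t : R) N : mesh s t N N.+1 = t.
Proof. by rewrite /mesh divfK ?subrKC. Qed.

Lemma mesh_lt (R : realType) (s t : R) N i : s < t ->
  mesh s t N i < mesh s t N i.+1.
Proof. by move=> st; rewrite meshS ltrDl divr_gt0// subr_gt0. Qed.

Lemma mesh_ge (R : realType) (s t : R) N i : s < t -> s <= mesh s t N i.
Proof.
by move=> st; rewrite /mesh lerDl mulr_ge0// divr_ge0// subr_ge0 ltW.
Qed.

Lemma mesh_le (R : realType) (s t : R) N i : s < t -> (i <= N.+1)%N ->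
  mesh s t N i <= t.
Proof.
move=> st iN; rewrite -[leRHS](mesh_end s t N) /mesh lerD2l ler_wpM2l//.
  by rewrite divr_ge0// subr_ge0 ltW.
by rewrite ler_nat.
Qed.

Definition ito_sum (R : realType) (alpha : R) (b : R -> R) (s t : R) (N : nat) :=
  \sum_(i < N.+1) expR (alpha * mesh s t N i) *
     (b (mesh s t N i.+1) - b (mesh s t N i)).

Section variation_of_constants.
Variables (R : realType) (alpha : R) (x b : R -> R).
Hypothesis cx : continuous x.
Hypothesis cb : continuous b.
Hypothesis dx : forall u : R, 0 < u ->
  is_derive u 1 (fun r => x r - b r) (- alpha * x u).

Let f (r : R) := expR (alpha * r).

Let df (u : R) : is_derive u 1 f (alpha * f u).
Proof.
have h : is_derive u 1 (fun r : R => alpha * r) alpha.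
  by apply: is_derive_eq; rewrite /GRing.scale/= mulr1.
by have := is_derive1_comp (is_derive_expR (alpha * u)) h; rewrite mulrC.
Qed.

Let cf : continuous f.
Proof. by move=> u; apply/differentiable_continuous/derivable1_diffP; have [] := df u. Qed.

(* The derivative at xi of the function h of [local_error]. It vanishes on
   the diagonal, hence is small near it. *)
Let D (u v xi : R) := alpha * (f xi * x v - f u * x xi).

(* Heine-Cantor, by the near-covering form of compactness. *)
Let D_small (s t e : R) : 0 < e -> exists2 k : R, 0 < k &
  forall u v xi : R, s <= u <= t -> `|v - u| < k -> `|xi - u| < k -> `|D u v xi| < e.
Proof.
move=> e0.
have cD : continuous (fun z : (R * R) * R => D z.1.1 z.1.2 z.2).
  have comp (h : R -> R) (g : (R * R) * R -> R) :
      continuous h -> continuous g -> continuous (h \o g).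
    by move=> ch cg z; apply: continuous_comp; [exact: cg|exact: ch].
  have c1 : continuous (fun z : (R * R) * R => z.1.1).
    by move=> z; apply: (@continuous_comp _ _ _ fst fst); exact: cvg_fst.
  have c2 : continuous (fun z : (R * R) * R => z.1.2).
    move=> z; apply: (@continuous_comp _ _ _ fst snd); first exact: cvg_fst.
    exact: cvg_snd.
  have c3 : continuous (fun z : (R * R) * R => z.2) by move=> z; exact: cvg_snd.
  move=> z; rewrite /D; apply: cvgM; first exact: cvg_cst.
  apply: cvgB; apply: cvgM.
  - exact: (comp _ _ cf c3 z).
  - exact: (comp _ _ cx c2 z).
  - exact: (comp _ _ cf c1 z).
  - exact: (comp _ _ cx c3 z).
have /compact_near_coveringP/(_ _ (0^'+) (fun k u => forall v xi,
    `|v - u| < k -> `|xi - u| < k -> `|D u v xi| < e)) := @segment_compact R s t.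
move=> /(_ _)[|k kP].
- move=> u0 _.
  have /cvgrPdist_lt/(_ _ e0)/nbhs_ballP[r /= r0 rP] := cD ((u0, u0), u0).
  have DD : D u0 u0 u0 = 0 by rewrite /D subrr mulr0.
  exists (ball u0 (r / 2), [set k | k < r / 2]); first split => /=.
  + by apply: nbhsx_ballx; rewrite divr_gt0.
  + by apply: nbhs_right_lt; rewrite divr_gt0.
  move=> [u k] /= [u0u kr] v xi vu xiu; rewrite /ball/= in u0u.
  have tri y : `|y - u| < k -> `|u0 - y| < r.
    move=> yu; rewrite (_ : u0 - y = (u0 - u) + (u - y)); last by ring.
    by rewrite (le_lt_trans (ler_normD _ _))// [`|u - y|]distrC; lra.
  have := rP ((u, v), xi); rewrite /= DD sub0r normrN; apply.
  by split; first split => /=; [|exact: tri|exact: tri]; rewrite /ball/=; lra.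
move=> kQ; have k2 : 0 < k / 2 by rewrite divr_gt0.
exists (k / 2) => // u v xi sut; apply: (kQ (k / 2)) => //=.
  by rewrite sub0r normrN gtr0_norm//; have : 0 < k by []; lra.
Qed.

Let local_error (s t e : R) : 0 <= s -> 0 < e -> exists2 k : R, 0 < k &
  forall u v : R, s <= u -> u < v -> v <= t -> v - u < k ->
    `|(f v * x v - f u * x u) - f u * (b v - b u)| <= e * (v - u).
Proof.
move=> s0 e0; have [k k0 kP] := D_small s t e0; exists k => // u v su uv vt vuk.
(* h is chosen so that h v - h u is the error of one term and so that the
   non-differentiable b enters only through x - b. *)
pose h r := f u * (x r - b r) + x v * f r.
have dh r : r \in `]u, v[ -> is_derive r 1 h (D u v r).
  rewrite in_itv/= => /andP[ur rv]; have r0 : 0 < r by lra.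
  have := dx r0 => dxr; have := df r => dfr.
  by apply: is_derive_eq; rewrite /D /GRing.scale/=; ring.
have ch : {within `[u, v], continuous h}.
  apply: continuous_subspaceT => r; apply: cvgD; apply: cvgM.
  - exact: cvg_cst.
  - by apply: cvgB; [exact: cx|exact: cb].
  - exact: cvg_cst.
  - exact: cf.
have [r] := MVT uv dh ch; rewrite in_itv/= => /andP[ur rv] hE.
have -> : f v * x v - f u * x u - f u * (b v - b u) = h v - h u.
  by rewrite /h; ring.
have v0 : 0 < v - u by rewrite subr_gt0.
rewrite hE normrM (gtr0_norm v0) ler_pM2r// ltW// kP//.
- by rewrite su (le_trans (ltW uv)).
- by rewrite gtr0_norm.
- by rewrite gtr0_norm ?subr_gt0//; lra.
Qed.

(** The discrete form of d (e^(alpha u) x) = e^(alpha u) db: each term of the sum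
    misses the increment of e^(alpha u) x by o(mesh). *)
Lemma variation_of_constants (s t : R) : 0 <= s -> s < t ->
  ito_sum alpha b s t @ \oo -->
    expR (alpha * t) * x t - expR (alpha * s) * x s.
Proof.
move=> s0 st; have ts0 : 0 < t - s by rewrite subr_gt0.
apply/cvgrPdist_le => /= e e0.
have e1 : 0 < e / (t - s) by rewrite divr_gt0.
have [k k0 kP] := local_error t s0 e1.
have kt0 : 0 < k / (t - s) by rewrite divr_gt0.
have := near_infty_natSinv_lt (PosNum kt0); apply: filterS => /= N.
rewrite ltr_pdivlMr// mulrC => Nk.
have dist i : mesh s t N i.+1 - mesh s t N i = (t - s) / N.+1%:R.
  by rewrite meshS addrC addKr.
have -> : expR (alpha * t) * x t - expR (alpha * s) * x s =
    \sum_(i < N.+1) (f (mesh s t N i.+1) * x (mesh s t N i.+1) -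
                     f (mesh s t N i) * x (mesh s t N i)).
  rewrite -(big_mkord xpredT (fun i => f (mesh s t N i.+1) * x (mesh s t N i.+1) -
    f (mesh s t N i) * x (mesh s t N i))).
  by rewrite telescope_sumr// mesh_end mesh0.
rewrite /ito_sum -sumrB (le_trans (ler_norm_sum _ _ _))//.
have -> : e = \sum_(i < N.+1) e / (t - s) * ((t - s) / N.+1%:R).
  rewrite sumr_const card_ord -[RHS]mulr_natr.
  have : N.+1%:R != 0 :> R by [].
  by move: N.+1%:R => n n0; field; rewrite n0 gt_eqF.
apply: ler_sum => i _; rewrite -(dist i); apply: kP.
- exact: mesh_ge.
- exact: mesh_lt.
- exact: mesh_le.
- by rewrite dist.
Qed.

End variation_of_constants.

(** * Logarithmic time *)

(** The time t at which T - t = T exp (- u). *)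
Definition clock (R : realType) (T u : R) : R := T * (1 - expR (- u)).

Section clock.
Variables (R : realType) (T : R).
Hypothesis T0 : 0 < T.
Local Notation D := (`[0, T[%classic : set R).

Lemma clock_in (u : R) : clock T `|u| \in D.
Proof.
rewrite inE/= in_itv/= /clock; apply/andP; split.
  by rewrite mulr_ge0 ?(ltW T0)// subr_ge0 -[leRHS]expR0 ler_expR oppr_le0.
by rewrite -[ltRHS]mulr1 ltr_pM2l// ltrBlDr ltrDl expR_gt0.
Qed.

(** The absolute value makes the path in log-time continuous on all of R, rather
    than only on one side at 0. *)
Definition time_point (u : R) : D :=
  exist (fun t : R => t \in D) (clock T `|u|) (clock_in u).

Lemma is_derive_clock (u : R) : is_derive u 1 (clock T) (T * expR (- u)).
Proof.
have dN : is_derive u 1 (fun r : R => expR (- r)) (- expR (- u)).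
  have := is_derive1_comp (is_derive_expR (- u)) (is_deriveN (is_derive_id u 1)).
  by rewrite mulrN1.
apply: is_derive_eq; rewrite /GRing.scale/=; ring.
Qed.

Lemma continuous_clock : continuous (clock T).
Proof.
by move=> u; apply/differentiable_continuous/derivable1_diffP; have [] := is_derive_clock u.
Qed.

Lemma continuous_clock_norm : continuous (fun u : R => clock T `|u|).
Proof.
by move=> u; apply: continuous_comp; [exact: norm_continuous|exact: continuous_clock].
Qed.

Lemma continuous_time_point : continuous time_point.
Proof.
apply: (@continuous_comp_initial D R R set_val); exact: continuous_clock_norm.
Qed.

Lemma continuous_path (h : path_space T) : continuous (fun u : R => h (time_point u)).
Proof.
move=> u; apply: (@continuous_comp _ _ _ time_point h).
  exact: continuous_time_point.
exact: cts_fun.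
Qed.

Lemma clock_inv (s : R) : 0 <= s < T ->
  0 <= - ln ((T - s) / T) /\ clock T (- ln ((T - s) / T)) = s.
Proof.
move=> /andP[s0 sT]; have q0 : 0 < (T - s) / T by rewrite divr_gt0// subr_gt0.
split; last first.
  rewrite /clock opprK lnK ?posrE//; field; exact: lt0r_neq0.
rewrite oppr_ge0 -ln1 ler_ln ?posrE// ler_pdivrMr// mul1r; lra.
Qed.

End clock.

Lemma clock_lt (R : realType) (T u v : R) : 0 < T -> u < v ->
  clock T u < clock T v.
Proof. by move=> T0 uv; rewrite ltr_pM2l// ltrD2l ltrN2 ltr_expR ltrN2. Qed.

Lemma clock0 (R : realType) (T : R) : clock T 0 = 0.
Proof. by rewrite /clock oppr0 expR0 subrr mulr0. Qed.

Section ornstein_uhlenbeck.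
Context (R : realType) (d : measure_display) (Omega : measurableType d)
  (P : probability Omega R) (B : R -> {RV P >-> R}) (T alpha : R)
  (X : continuous_process Omega T).
Hypothesis T0 : 0 < T.
Local Notation D := (`[0, T[%classic : set R).

Definition timed (w : Omega) (u : R) : R := X w (time_point T0 u).

Definition timed_noise (w : Omega) (u : R) : R := B (clock T `|u|) w.

Let sde (w : Omega) := forall t : D,
  X w t = \int[lebesgue_measure]_(s in `[0, val t])
              (- (alpha / (T - s)) * 'valL_ 0 (X w) s) + B (val t) w.

Lemma continuous_timed w : continuous (timed w).
Proof. exact: continuous_path. Qed.

Lemma continuous_timed_noise w : wiener_process B -> continuous (timed_noise w).
Proof.
move=> wB; pose Bw (t : R) := B t w.
have cB : {within `[0, +oo[, continuous Bw} :=
  @wiener_continuous _ _ _ _ _ wB w.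
move/subspace_sigL_continuousP : cB => cB.
have ge0 (u : R) : clock T `|u| \in (`[0, +oo[%classic : set R).
  have := clock_in T0 u; rewrite !inE/= !in_itv/= => /andP[-> _]//.
pose h (u : R) : (`[0, +oo[%classic : set R) := exist _ (clock T `|u|) (ge0 u).
have ch : continuous h.
  apply: (@continuous_comp_initial (`[0, +oo[%classic : set R) R R set_val).
  exact: continuous_clock_norm.
by move=> u; exact: (@continuous_comp _ _ _ h _ u (ch u) (cB _)).
Qed.

(* The integrand of the equation, with the path read in log-time: it agrees with
   the original one on [0, T[ and is continuous on all of ]-oo, T[. *)
Let drift w (s : R) : R := - (alpha / (T - s)) * timed w (- ln ((T - s) / T)).

Let driftE w (s : R) : 0 <= s < T ->
  - (alpha / (T - s)) * 'valL_ 0 (X w) s = drift w s.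
Proof.
move=> s0T; have [n0 nE] := clock_inv T0 s0T; rewrite /drift; congr (_ * _).
rewrite -{1}nE -{1}(ger0_norm n0).
exact: (congr1 (fun f => f (time_point T0 _)) (valLK (0 : R) (X w))).
Qed.

Let continuous_drift w (s : R) : s < T -> {for s, continuous (drift w)}.
Proof.
move=> sT; have Ts : 0 < T - s by rewrite subr_gt0.
have cTs : {for s, continuous (fun s : R => T - s)}.
  by apply: cvgB; [exact: cvg_cst|exact: cvg_id].
apply: cvgM.
  apply: cvgN; apply: cvgM; first exact: cvg_cst.
  by apply: cvgV => //; rewrite gt_eqF.
apply: (@continuous_comp _ _ _ (fun s => - ln ((T - s) / T)) (timed w)); last first.
  exact: continuous_timed.
apply: cvgN; apply: (@continuous_comp _ _ _ (fun s => (T - s) / T) (@ln R)).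
  by apply: cvgM; [exact: cTs|exact: cvg_cst].
by apply: continuous_ln; rewrite divr_gt0.
Qed.

(** In log-time the singular drift alpha / (T - t) becomes the constant alpha. *)
Lemma timed_drift w (u : R) : sde w -> 0 < u ->
  is_derive u 1 (fun r => timed w r - timed_noise w r) (- alpha * timed w u).
Proof.
move=> Xw u0; pose F (y : R) : R := \int[lebesgue_measure]_(s in `[0, y]) drift w s.
have near0 : \forall r \near u, 0 < r by exact: lt_nbhsr.
have eF : \forall r \near u, (F \o clock T) r = timed w r - timed_noise w r.
  near=> r; have r0 : 0 < r by near: r.
  rewrite /timed Xw /timed_noise/= addrK -[in LHS](gtr0_norm r0).
  apply: eq_Rintegral => s; rewrite inE/= in_itv/= => /andP[s0 sr].
  rewrite driftE// s0 (le_lt_trans sr)//.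
  by have := clock_in T0 r; rewrite inE/= in_itv/= => /andP[].
apply: (near_eq_is_derive eF).
have t0 : 0 < clock T u.
  by rewrite mulr_gt0// subr_gt0 -[ltRHS]expR0 ltr_expR oppr_lt0.
have tT : clock T u < T.
  have := clock_in T0 u; rewrite (gtr0_norm u0) inE/= in_itv/= => /andP[]//.
pose v := (clock T u + T) / 2.
have tv : clock T u < v by rewrite /v; lra.
have vT : v < T by rewrite /v; lra.
have int : lebesgue_measure.-integrable `[0, v] (EFin \o drift w).
  apply: continuous_compact_integrable; first exact: segment_compact.
  apply: continuous_in_subspaceT => s; rewrite inE/= in_itv/= => /andP[_ sv].
  exact/continuous_drift/(le_lt_trans sv).
have [dF F'] := continuous_FTC1_closed tv int t0 (continuous_drift (w := w) tT).
have {}dF : is_derive (clock T u) 1 F (drift w (clock T u)).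
  by apply: DeriveDef => //; rewrite -derive1E.
apply: (is_derive_eq (is_derive1_comp dF (is_derive_clock T u))).
have q : (T - clock T u) / T = expR (- u).
  by rewrite /clock; field; exact: lt0r_neq0.
have q' : T - clock T u = T * expR (- u) by rewrite /clock; ring.
rewrite /drift q expRK opprK q'.
have := expR_gt0 (- u); set e := expR (- u) => e0.
by field; rewrite !gt_eqF.
Unshelve. all: by end_near. Qed.

Lemma timed0 w : sde w -> B 0 w = 0 -> timed w 0 = 0.
Proof.
move=> Xw B0; rewrite /timed Xw/= normr0.
by rewrite clock0 set_itv1 Rintegral_set1 B0 addr0.
Qed.

(** The solution as a pathwise limit of sums of Wiener increments, which are
    measurable for the natural filtration whereas the solution itself is only
    adapted to the augmented one. *)
Lemma timed_cvg : wiener_process B -> strong_solution B alpha X ->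
  {ae P, forall w, timed w 0 = 0 /\ forall s t : R, 0 <= s -> s < t ->
    ito_sum alpha (timed_noise w) s t @ \oo -->
      expR (alpha * t) * timed w t - expR (alpha * s) * timed w s}.
Proof.
move=> wB sX; have := wiener_start wB; have := solution_sde sX.
apply: filterS2 => w Xw B0; split; first exact: timed0 Xw B0.
move=> s t s0 st; apply: variation_of_constants => //.
- exact: continuous_timed.
- exact: continuous_timed_noise.
- by move=> u u0; exact: timed_drift.
Qed.

End ornstein_uhlenbeck.

(** * Accumulated variance *)

(** The integral of exp (theta r) for r in [0, h]. *)
Definition ou_growth (R : realType) (theta h : R) : R :=
  if theta == 0 then h else (expR (theta * h) - 1) / theta.

Section ou_growth.
Variables (R : realType) (theta : R).

Lemma is_derive_ou_growth (h : R) :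
  is_derive h 1 (ou_growth theta) (expR (theta * h)).
Proof.
have [->|t0] := eqVneq theta 0.
  rewrite mul0r expR0 (_ : ou_growth 0 = id); first exact: is_derive_id.
  by apply/funext => y; rewrite /ou_growth eqxx.
rewrite (_ : ou_growth theta = fun y => theta^-1 * (expR (theta * y) - 1)); last first.
  by apply/funext => y; rewrite /ou_growth (negbTE t0) mulrC.
have dl : is_derive h 1 (fun y : R => theta * y) theta.
  by apply: is_derive_eq; rewrite /GRing.scale/= mulr1.
have de := is_derive1_comp (is_derive_expR (theta * h)) dl.
have de' : is_derive h 1 (fun y : R => expR (theta * y)) (expR (theta * h) * theta).
  exact: de.
by apply: is_derive_eq; rewrite /GRing.scale/=; field.
Qed.

Lemma ou_growth0 : ou_growth theta 0 = 0.
Proof. by rewrite /ou_growth; case: ifP => // _; rewrite mulr0 expR0 subrr mul0r. Qed.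

Lemma ou_growth_shift (s t : R) :
  expR (theta * t) * (ou_growth (- theta) t - ou_growth (- theta) s) =
  ou_growth theta (t - s).
Proof.
rewrite /ou_growth oppr_eq0; case: ifPn => [/eqP ->|t0].
  by rewrite mul0r expR0 mul1r.
have -> : expR (theta * (t - s)) = expR (theta * t) * expR (- theta * s).
  by rewrite -expRD; congr expR; ring.
have -> : expR (theta * t) = (expR (- theta * t))^-1.
  by rewrite -expRN mulNr opprK.
have := expR_gt0 (- theta * t); move: (expR _) => e e0.
by field; rewrite t0 gt_eqF.
Qed.

Lemma ou_growth_le (s t : R) : s <= t -> ou_growth theta s <= ou_growth theta t.
Proof.
move=> st; have [|r _ E] := MVT_segment st (fun r _ => is_derive_ou_growth r).
  apply: continuous_subspaceT => r.
  by apply/differentiable_continuous/derivable1_diffP; have [] := is_derive_ou_growth r.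
by rewrite -subr_ge0 E mulr_ge0 ?expR_ge0 ?subr_ge0.
Qed.

Lemma ou_growth_ge0 (h : R) : 0 <= h -> 0 <= ou_growth theta h.
Proof. by move=> /ou_growth_le; rewrite ou_growth0. Qed.

End ou_growth.

(** The variance e^(2 alpha u) dt accumulated by the Riemann sums solves a linear
    equation of the same shape, with 2 alpha for alpha and [clock] for the noise, so
    [variation_of_constants] computes its limit. *)
Lemma mesh_variance_cvg (R : realType) (T alpha s t : R) : 0 <= s -> s < t ->
  ito_sum (2 * alpha) (clock T) s t @ \oo -->
    T * (ou_growth (- (1 - 2 * alpha)) t - ou_growth (- (1 - 2 * alpha)) s).
Proof.
move=> s0 st; set th := - (1 - 2 * alpha).
pose x (u : R) := expR (- (2 * alpha) * u) * (T * ou_growth th u).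
have dE (u : R) : is_derive u 1 (fun y : R => expR (- (2 * alpha) * y))
    (- (2 * alpha) * expR (- (2 * alpha) * u)).
  have dl : is_derive u 1 (fun y : R => - (2 * alpha) * y) (- (2 * alpha)).
    by apply: is_derive_eq; rewrite /GRing.scale/= mulr1.
  exact: (is_derive_eq (is_derive1_comp (is_derive_expR (- (2 * alpha) * u)) dl) (mulrC _ _)).
have dx (u : R) : is_derive u 1 (fun r => x r - clock T r) (- (2 * alpha) * x u).
  have dg := is_derive_ou_growth th u; have dt := is_derive_clock T u.
  have d1 := dE u; rewrite /x; apply: is_derive_eq; rewrite /GRing.scale/=.
  have -> : expR (- u) = expR (- (2 * alpha) * u) * expR (th * u).
    by rewrite -expRD; congr expR; rewrite /th; ring.
  by ring.
have ct : continuous (clock T) by exact: continuous_clock.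
have cxt : continuous (fun r => x r - clock T r).
  by move=> u; apply/differentiable_continuous/derivable1_diffP; have [] := dx u.
have cx : continuous x.
  move=> u; rewrite (_ : x = fun r => (x r - clock T r) + clock T r); last first.
    by apply/funext => r; rewrite subrK.
  by apply: cvgD; [exact: cxt|exact: ct].
have := variation_of_constants cx ct (fun u _ => dx u) s0 st.
have e1 (r : R) : expR (2 * alpha * r) * x r = T * ou_growth th r.
  by rewrite /x mulrA -expRD -mulrDl subrr mul0r expR0 mul1r.
by rewrite !e1 -mulrBr.
Qed.

(** * Coordinates of the path space *)

(** Uniform convergence on compact sets implies convergence on singletons. *)
Lemma continuous_eval (R : realType) (T : R) (t : (`[0, T[%classic : set R)) :
  continuous (fun h : path_space T => h t).
Proof.
move=> g.
apply: (@continuous_comp (path_space T)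
  {family compact, (`[0, T[%classic : set R) -> R} R
  (fun h : path_space T => (h : {family compact, (`[0, T[%classic : set R) -> R}))
  (fun f => f t) g).
  exact: (@initial_continuous _ _ (fun h : path_space T =>
    (h : {family compact, (`[0, T[%classic : set R) -> R}))).
pose K := {family compact, (`[0, T[%classic : set R) -> R}.
have gg : {family compact, nbhs (g : K) --> (g : (`[0, T[%classic : set R) -> R)}.
  exact: cvg_id.
have := (@fam_cvgP _ _ compact _ _ (nbhs_filter (g : K))).1 gg [set t].
move=> /(_ (@compact_set1 _ t)).
by rewrite uniform_set1.
Qed.

Lemma measurable_eval (R : realType) (T : R) (t : (`[0, T[%classic : set R)) :
  measurable_fun setT (fun h : path_space T => h t).
Proof.
apply: (measurability (@RGenOpens.G R)); first exact: RGenOpens.measurableE.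
move=> _ [_ [a [b ->]] <-]; rewrite setTI; apply: sub_sigma_algebra.
move: a b => a b; apply: open_comp; last exact: interval_open.
by move=> h _; exact: continuous_eval.
Qed.

(** * Transition of the observables *)

Section transition.
Context (R : realType) (d : measure_display) (Omega : measurableType d)
  (P : probability Omega R) (B : R -> {RV P >-> R}) (T alpha : R)
  (X : continuous_process Omega T).
Hypothesis T0 : 0 < T.
Hypothesis wB : wiener_process B.
Hypothesis sX : strong_solution B alpha X.

Local Notation x := (timed X T0).
Local Notation theta := (1 - 2 * alpha).

Lemma measurable_timed u : measurable_fun setT (fun w => x w u).
Proof. exact: measurable_coordinate. Qed.

Lemma ito_sum_timedE w (s t k : R) N : 0 <= s -> s < t ->
  k * ito_sum alpha (timed_noise B T w) s t N =
  \sum_(i < N.+1) (k * expR (alpha * mesh s t N i)) *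
    (B (clock T (mesh s t N i.+1)) w - B (clock T (mesh s t N i)) w).
Proof.
move=> s0 st; rewrite mulr_sumr; apply: eq_bigr => i _; rewrite mulrA /timed_noise.
by rewrite !ger0_norm// (le_trans s0)// mesh_ge.
Qed.

(** The Markov property on the observables. The value of the path at s enters
    through approximations Y that belong to the natural filtration; both sides are
    limits of the two sides of [wiener_sum]. *)
Lemma transition (s t c1 c : R) (Y : nat -> Omega -> R) :
  0 <= s -> s < t -> 0 <= c1 -> 0 <= c ->
  (forall N, past_measurable B (clock T s) (Y N)) ->
  {ae P, forall w, Y ^~ w @ \oo --> x w s} ->
  let v := expR (- (2 * alpha * t)) *
    (T * (ou_growth (- theta) t - ou_growth (- theta) s)) in
  (\int[P]_w (damp c1 (x w s) * damp c (x w t))%:E =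
   \int[P]_w (laplace_sqr (c * v) * (damp c1 (x w s) *
     damp (c / (1 + 2 * (c * v))) (expR (alpha * (s - t)) * x w s)))%:E)%E.
Proof.
move=> s0 st c10 c0 pY Yx v.
pose k N i := expR (- (alpha * t)) * expR (alpha * mesh s t N i).
pose p N i := clock T (mesh s t N i).
have p0 N : p N 0 = clock T s by rewrite /p mesh0.
have p_ge0 N : 0 <= p N 0.
  rewrite p0 -(clock0 T); move: s0; rewrite le_eqVlt => /orP[/eqP <-//|s0].
  exact/ltW/clock_lt.
have pS N i : p N i < p N i.+1 by apply: clock_lt => //; exact: mesh_lt.
pose S N w := \sum_(i < N.+1) k N i * (B (p N i.+1) w - B (p N i) w).
pose V N := \sum_(i < N.+1) k N i ^+ 2 * (p N i.+1 - p N i).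
pose Y' N w := expR (alpha * (s - t)) * Y N w.
have V0 N : 0 <= V N.
  by apply: sumr_ge0 => i _; rewrite mulr_ge0 ?sqr_ge0// subr_ge0 ltW.
have v0 : 0 <= v.
  rewrite mulr_ge0 ?expR_ge0// mulr_ge0 ?(ltW T0)// subr_ge0.
  by apply: ou_growth_le; exact: ltW.
have Vv : V @ \oo --> v.
  have -> : V = fun N => expR (- (2 * alpha * t)) * ito_sum (2 * alpha) (clock T) s t N.
    apply/funext => N; rewrite mulr_sumr; apply: eq_bigr => i _.
    rewrite mulrA /k exprMn -!expRM_natl; congr (_ * _ * _); congr expR; ring.
  by apply: cvgM; [exact: cvg_cst|exact: mesh_variance_cvg].
have pY' N : past_measurable B (p N 0) (Y' N).
  by rewrite p0; apply: measurable_funM => //; exact: pY.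
have pZ N : past_measurable B (p N 0) (fun w => damp c1 (Y N w)).
  by rewrite p0; apply: measurable_damp; exact: pY.
have YS : {ae P, forall w, (Y' N w + S N w) @[N --> \oo] --> x w t}.
  apply: filterS2 Yx (timed_cvg T0 wB sX) => w Yw [_ /(_ s t s0 st) Sw].
  have -> : x w t = expR (alpha * (s - t)) * x w s +
      expR (- (alpha * t)) * (expR (alpha * t) * x w t - expR (alpha * s) * x w s).
    have -> : expR (alpha * (s - t)) = expR (- (alpha * t)) * expR (alpha * s).
      by rewrite -expRD; congr expR; ring.
    have := expRxMexpNx_1 (alpha * t); move: (expR _) (expR (- _)) => e f ef.
    by rewrite -[LHS]mul1r -ef; ring.
  apply: cvgD; first by apply: cvgM; [exact: cvg_cst|exact: Yw].
  rewrite (_ : S ^~ w = fun N => expR (- (alpha * t)) *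
    ito_sum alpha (timed_noise B T w) s t N); last first.
    by apply/funext => N; rewrite ito_sum_timedE.
  by apply: cvgM; [exact: cvg_cst|exact: Sw].
have mY N : measurable_fun setT (Y N) by exact: past_measurable_measurable (pY N).
have mYS N : measurable_fun setT (fun w => Y' N w + S N w).
  have pYS : past_measurable B (p N N.+1) (fun w => Y' N w + S N w).
    exact: (past_measurable_sum (k N) (p_ge0 N) (pS N) (pY' N)).
  exact: past_measurable_measurable pYS.
have cV0 w : 0 <= w -> 0 <= c / (1 + 2 * (c * w)).
  by move=> w0; rewrite divr_ge0// addr_ge0// mulr_ge0// mulr_ge0.
have L : (\int[P]_w (damp c1 (Y N w) * damp c (Y' N w + S N w))%:E @[N --> \oo] -->
    \int[P]_w (damp c1 (x w s) * damp c (x w t))%:E)%E.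
  apply: unit_interval_cvg.
  - by move=> N; apply: measurable_funM; exact: measurable_damp.
  - by apply: measurable_funM; apply: measurable_damp; exact: measurable_timed.
  - by move=> N w; rewrite mulr_ge0 ?damp_ge0// mulr_ile1 ?damp_ge0 ?damp_le1.
  apply: filterS2 Yx YS => w Yw Sw.
  by apply: cvgM; apply: damp_cvg => //; exact: cvg_cst.
have Rl : (\int[P]_w (laplace_sqr (c * V N) * (damp c1 (Y N w) *
     damp (c / (1 + 2 * (c * V N))) (Y' N w)))%:E @[N --> \oo] -->
   \int[P]_w (laplace_sqr (c * v) * (damp c1 (x w s) *
     damp (c / (1 + 2 * (c * v))) (expR (alpha * (s - t)) * x w s)))%:E)%E.
  apply: unit_interval_cvg.
  - move=> N; apply: measurable_funM => //; apply: measurable_funM; apply: measurable_damp => //.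
    exact: measurable_funM.
  - apply: measurable_funM => //; apply: measurable_funM; apply: measurable_damp.
      exact: measurable_timed.
    by apply: measurable_funM => //; exact: measurable_timed.
  - move=> N w; have ? := cV0 _ (V0 N).
    rewrite !mulr_ge0 ?damp_ge0 ?laplace_sqr_ge0// mulr_ile1 ?mulr_ge0 ?damp_ge0 ?laplace_sqr_ge0//.
      by rewrite laplace_sqr_le1// mulr_ge0.
    by rewrite mulr_ile1 ?damp_ge0 ?damp_le1.
  apply: filterS Yx => w Yw.
  have cVv : c * V N @[N --> \oo] --> c * v by apply: cvgM => //; exact: cvg_cst.
  apply: cvgM; first by apply: laplace_sqr_cvg => //; rewrite mulr_ge0.
  apply: cvgM; apply: damp_cvg => //; first exact: cvg_cst.
    apply: cvgM; first exact: cvg_cst.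
    apply: cvgV; first by rewrite gt_eqF// ltr_pwDl// mulr_ge0// mulr_ge0.
    by apply: cvgD; [exact: cvg_cst|apply: cvgM => //; exact: cvg_cst].
  by apply: cvgM; [exact: cvg_cst|exact: Yw].
suff LR : (fun N => \int[P]_w (damp c1 (Y N w) * damp c (Y' N w + S N w))%:E)%E =
    (fun N => \int[P]_w (laplace_sqr (c * V N) * (damp c1 (Y N w) *
     damp (c / (1 + 2 * (c * V N))) (Y' N w)))%:E)%E.
  by rewrite LR in L; exact: (cvg_unique (@ereal_hausdorff R) L Rl).
apply/funext => N.
rewrite (wiener_sum wB (k N) (p_ge0 N) (pS N) N.+1 (pY' N) (pZ N))//; last first.
  by move=> w; exact: damp_ge0.
rewrite -ge0_integralZl//.
- by apply/measurable_EFinP/measurable_funM; apply: measurable_damp => //; exact: measurable_funM.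
- by move=> w _; rewrite lee_fin mulr_ge0 ?damp_ge0.
- by rewrite lee_fin laplace_sqr_ge0.
Qed.

End transition.

Section observables.
Context (R : realType) (d : measure_display) (Omega : measurableType d)
  (P : probability Omega R) (B : R -> {RV P >-> R}) (T alpha : R)
  (X : continuous_process Omega T).
Hypothesis T0 : 0 < T.
Hypothesis wB : wiener_process B.
Hypothesis sX : strong_solution B alpha X.

Local Notation theta := (1 - 2 * alpha).

(** The factor exp t / T is the inverse of T - clock T t, the natural variance scale
    at log-time t. *)
Definition obs (k t : R) (h : path_space T) : R :=
  damp (k * (expR t / T)) (h (time_point T0 t)).

Lemma measurable_obs k t : measurable_fun setT (obs k t).
Proof. by apply: measurable_damp; exact: measurable_eval. Qed.

Lemma obs_ge0 k t h : 0 <= obs k t h.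
Proof. exact: damp_ge0. Qed.

Let weight_ge0 k t : 0 <= k -> 0 <= k * (expR t / T).
Proof. by move=> k0; rewrite mulr_ge0// divr_ge0 ?expR_ge0// ltW. Qed.

Lemma obs_le1 k t h : 0 <= k -> obs k t h <= 1.
Proof. by move=> k0; apply: damp_le1; exact: weight_ge0. Qed.

Lemma measurable_obs_process k t : measurable_fun setT (fun w => obs k t (X w)).
Proof. by apply: measurable_damp; exact: measurable_coordinate. Qed.

Let weightE k s t : k * (expR t / T) * (expR (- (2 * alpha * t)) *
    (T * (ou_growth (- theta) t - ou_growth (- theta) s))) =
  k * ou_growth theta (t - s).
Proof.
rewrite -ou_growth_shift (_ : expR (theta * t) = expR t * expR (- (2 * alpha * t))).
  by field; exact: lt0r_neq0.
by rewrite -expRD; congr expR; ring.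
Qed.

(** The instance s = 0 of [transition], where the path starts from 0. *)
Lemma mean_obs k t : 0 <= k -> 0 < t ->
  (\int[P]_w (obs k t (X w))%:E = (laplace_sqr (k * ou_growth theta t))%:E)%E.
Proof.
move=> k0 t0; have pY : past_measurable B (clock T 0) (fun=> 0 : R) by exact: measurable_cst.
have start := timed_cvg T0 wB sX.
have Yx : {ae P, forall w, (fun _ : nat => 0 : R) @ \oo --> timed X T0 w 0}.
  by apply: filterS start => w [-> _]; exact: cvg_cst.
have := transition wB sX (lexx 0) t0 (lexx 0) (weight_ge0 t k0) (fun=> pY) Yx.
rewrite /= weightE subr0 => E.
transitivity (\int[P]_w (damp 0 (timed X T0 w 0) *
    damp (k * (expR t / T)) (timed X T0 w t))%:E)%E.
  by apply: eq_integral => w _; rewrite {1}/damp mul0r oppr0 expR0 mul1r.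
rewrite E -[RHS]mule1 -[X in (_ * X)%E](@probability_setT _ _ _ P).
rewrite -(integral_cst P measurableT).
apply: ae_eq_integral => //.
- apply/measurable_EFinP; apply: measurable_funM => //; apply: measurable_funM;
    apply: measurable_damp; first exact: measurable_coordinate.
  by apply: measurable_funM => //; exact: measurable_coordinate.
- apply: filterS start => w [-> _] _ /=.
  by rewrite mulr0 /damp expr2 !mulr0 oppr0 expR0 !mulr1.
Qed.

(** The exponential that remains after [transition] is bounded by 1: for
    k1 = k = 1 the product on the right still has the same limit as the product of
    the two means when s and t - s tend to infinity. *)
Lemma corr_obs k1 k s t : 0 <= k1 -> 0 <= k -> 0 < s -> s < t ->
  (\int[P]_w (obs k1 s (X w) * obs k t (X w))%:E <=
   (laplace_sqr (k * ou_growth theta (t - s)) *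
    laplace_sqr (k1 * ou_growth theta s))%:E)%E.
Proof.
move=> k10 k0 s0 st.
pose q N i := clock T (mesh 0 s N i).
have q0 N : q N 0 = 0 by rewrite /q mesh0 clock0.
have qS N i : q N i < q N i.+1 by apply: clock_lt => //; exact: mesh_lt.
pose Y N w := expR (- (alpha * s)) * ito_sum alpha (timed_noise B T w) 0 s N.
have pY N : past_measurable B (clock T s) (Y N).
  have p0 : past_measurable B (q N 0) (fun=> 0 : R) by exact: measurable_cst.
  have qN0 : 0 <= q N 0 by rewrite q0.
  have : past_measurable B (q N N.+1) _ := past_measurable_sum (fun i => expR (- (alpha * s)) *
    expR (alpha * mesh 0 s N i)) qN0 (qS N) p0.
  rewrite /q mesh_end; congr past_measurable; apply/funext => w.
  by rewrite add0r /Y ito_sum_timedE.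
have start := timed_cvg T0 wB sX.
have Yx : {ae P, forall w, Y ^~ w @ \oo --> timed X T0 w s}.
  apply: filterS start => w [x0 /(_ _ _ (lexx 0) s0)]; rewrite x0 mulr0 subr0 => L.
  rewrite -[timed X T0 w s]mul1r -[X in X * _](expRxMexpNx_1 (alpha * s)).
  rewrite [X in X * _]mulrC -mulrA.
  by apply: cvgM; [exact: cvg_cst|exact: L].
have := transition wB sX (ltW s0) st (weight_ge0 s k10) (weight_ge0 t k0) pY Yx.
rewrite /= weightE => E; rewrite [leLHS]E.
have W0 : 0 <= k * ou_growth theta (t - s).
  by rewrite mulr_ge0// ou_growth_ge0// subr_ge0 ltW.
rewrite EFinM -(mean_obs k10 s0) -ge0_integralZl//; last 3 first.
- by apply/measurable_EFinP; exact: measurable_obs_process.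
- by move=> w _; rewrite lee_fin obs_ge0.
- by rewrite lee_fin laplace_sqr_ge0.
apply: ge0_le_integral => //.
- by move=> w _; rewrite lee_fin !mulr_ge0 ?damp_ge0 ?laplace_sqr_ge0.
- apply/measurable_EFinP; apply: measurable_funM => //; apply: measurable_funM;
    apply: measurable_damp; first exact: measurable_coordinate.
  by apply: measurable_funM => //; exact: measurable_coordinate.
- apply/measurable_EFinP; apply: measurable_funM => //; exact: measurable_obs_process.
move=> w _; rewrite lee_fin ler_wpM2l ?laplace_sqr_ge0// ler_piMr ?damp_ge0//.
apply: damp_le1; rewrite divr_ge0 ?weight_ge0// addr_ge0// mulr_ge0//.
Qed.

End observables.

(** * Asymptotics of the means *)

Section growth_asymptotics.
Variable R : realType.
Implicit Types theta h v w e : R.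

(** The limit of the means as the log-time tends to infinity; the variance has the
    limit - theta^-1 when theta < 0 and diverges otherwise. *)
Definition stationary_mean theta : R :=
  if 0 <= theta then 0 else laplace_sqr (- theta^-1).

Lemma laplace_sqr_expr2 v : 0 <= v -> laplace_sqr v ^+ 2 = (1 + 2 * v)^-1.
Proof.
by move=> v0; rewrite /laplace_sqr exprVn sqr_sqrtr// addr_ge0// mulr_ge0.
Qed.

Lemma stationary_mean_ge0 theta : 0 <= stationary_mean theta.
Proof. by rewrite /stationary_mean; case: ifP => // _; exact: laplace_sqr_ge0. Qed.

Lemma ou_growth_ge theta h : 0 <= theta -> h <= ou_growth theta h.
Proof.
rewrite le_eqVlt /ou_growth => /orP[/eqP <-|t0]; first by rewrite eqxx.
by rewrite gt_eqF// ler_pdivlMr// lerBrDl mulrC expR_ge1Dx.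
Qed.

Lemma ou_growth_lt0 theta h : theta < 0 ->
  ou_growth theta h = - theta^-1 - expR (theta * h) / - theta.
Proof. by move=> t0; rewrite /ou_growth lt_eqF//; field; rewrite lt_eqF. Qed.

Lemma stationary_mean_le theta h : 0 <= h ->
  stationary_mean theta <= laplace_sqr (ou_growth theta h).
Proof.
move=> h0; rewrite /stationary_mean; case: ifPn => [_|]; first exact: laplace_sqr_ge0.
rewrite -ltNge => t0; apply: laplace_sqr_le; first exact: ou_growth_ge0.
by rewrite ou_growth_lt0// gerBl divr_ge0 ?expR_ge0// oppr_ge0 ltW.
Qed.

Lemma stationary_mean_cvg theta e : 0 < e -> \forall n \near \oo,
  laplace_sqr (ou_growth theta n.+1%:R) ^+ 2 <= stationary_mean theta ^+ 2 + e.
Proof.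
move=> e0; have [t0|t0] := leP 0 theta.
  have := nbhs_infty_ger (e^-1); apply: filterS => n en.
  rewrite /stationary_mean t0 expr0n add0r laplace_sqr_expr2 ?ou_growth_ge0//.
  rewrite -[leRHS]invrK lef_pV2 ?posrE ?invr_gt0 ?ltr_pwDl ?mulr_ge0 ?ou_growth_ge0//.
  have := ou_growth_ge n.+1%:R t0; have := ou_growth_ge0 theta (ler0n R n.+1).
  by rewrite -natr1; lra.
have := nbhs_infty_ger (2 / (theta ^+ 2 * e)); apply: filterS => n en.
rewrite /stationary_mean (lt_geF t0).
have V0 : 0 <= - theta^-1 by rewrite oppr_ge0 invr_le0 ltW.
have W0 := ou_growth_ge0 theta (ler0n R n.+1).
rewrite !laplace_sqr_expr2//.
have h0 : 0 < n.+1%:R :> R by [].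
set h := n.+1%:R in h0 W0 *; have {}en : 2 / (theta ^+ 2 * e) <= h.
  by rewrite (le_trans en)// ler_nat.
have VW : - theta^-1 - ou_growth theta h <= e / 2.
  have nt0 : 0 < - theta by rewrite oppr_gt0.
  have th0 : 0 < - theta * h by rewrite mulr_gt0.
  rewrite ou_growth_lt0// opprB subrKC.
  rewrite -[theta * h]opprK -mulNr expRN.
  apply: (@le_trans _ _ ((- theta * h)^-1 / - theta)).
    rewrite ler_wpM2r ?invr_ge0 ?(ltW nt0)// lef_pV2 ?posrE ?expR_gt0//.
    by apply: le_trans (expR_ge1Dx _); rewrite lerDr.
  rewrite -invfM -[leLHS]mul1r ler_pdivrMr ?mulr_gt0//.
  have t2 : 0 < theta ^+ 2 * e by rewrite mulr_gt0// exprn_even_gt0//= lt_eqF.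
  have : 2 <= h * (theta ^+ 2 * e) by rewrite -ler_pdivrMr.
  by rewrite !expr2; nra.
have W1 : 0 < 1 + 2 * ou_growth theta h by rewrite ltr_pwDl// mulr_ge0.
have V1 : 0 < 1 + 2 * - theta^-1 by rewrite ltr_pwDl// mulr_ge0.
move: V0 W0 VW W1 V1; move: (- theta^-1) (ou_growth theta h) => V W V0 W0 VW W1 V1.
rewrite -lerBlDl.
have -> : (1 + 2 * W)^-1 - (1 + 2 * V)^-1 = 2 * (V - W) / ((1 + 2 * W) * (1 + 2 * V)).
  by field; rewrite !gt_eqF.
rewrite ler_pdivrMr ?mulr_gt0//; apply: (@le_trans _ _ e); first by lra.
by rewrite ler_peMr ?(ltW e0)//; have := mulr_ge0 V0 W0; lra.
Qed.

Lemma stationary_mean_neq theta1 theta2 : theta1 != theta2 -> theta1 < 0 ->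
  stationary_mean theta1 != stationary_mean theta2.
Proof.
move=> t12 t1; rewrite /stationary_mean (lt_geF t1); case: ifPn => [_|].
  by rewrite gt_eqF// invr_gt0 sqrtr_gt0 ltr_pwDl// mulr_ge0// oppr_ge0 invr_le0 ltW.
rewrite -ltNge => t2; apply: contra t12 => /eqP/(congr1 (fun r => r ^+ 2)).
rewrite !laplace_sqr_expr2 ?oppr_ge0 ?invr_le0 ?ltW// => /invr_inj/addrI.
move=> /mulfI; rewrite pnatr_eq0 => /(_ isT)/oppr_inj/invr_inj ->.
exact: eqxx.
Qed.

(** The weight exp (- kappa h) decays more slowly than the variance grows. *)
Lemma spreading_mean_cvg0 theta kappa e : 0 <= theta -> kappa < theta -> 0 < e ->
  \forall n \near \oo,
    laplace_sqr (expR (- kappa * n.+1%:R) * ou_growth theta n.+1%:R) <= e.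
Proof.
move=> t0 kt e0; have d0 : 0 < theta - kappa by rewrite subr_gt0.
have := nbhs_infty_ger ((e ^- 2 + theta) / (theta - kappa)); apply: filterS => n.
rewrite ler_pdivrMr// => en.
set h := n.+1%:R; have h1 : 1 <= h by rewrite /h ler1n.
have hn : n%:R <= h by rewrite /h ler_nat.
have v0 : 0 <= expR (- kappa * h) * ou_growth theta h.
  by rewrite mulr_ge0 ?expR_ge0// ou_growth_ge0// (le_trans ler01).
rewrite -(@ler_pXn2r _ 2)// ?nnegrE ?laplace_sqr_ge0 ?(ltW e0)//.
rewrite laplace_sqr_expr2// -[leRHS]invrK lef_pV2 ?posrE ?invr_gt0 ?exprn_gt0//;
  last by rewrite ltr_pwDl// mulr_ge0.
suff : e ^- 2 <= expR (- kappa * h) * ou_growth theta h by lra.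
(* The mass of exp (theta r) on the last unit interval is already enough. *)
have step : expR (theta * (h - 1)) <= ou_growth theta h.
  have h10 : h - 1 < h by rewrite ltrBlDr ltrDl.
  have [|r] := MVT h10 (fun r _ => is_derive_ou_growth theta r).
    apply: continuous_subspaceT => r.
    by apply/differentiable_continuous/derivable1_diffP; have [] := is_derive_ou_growth theta r.
  rewrite in_itv/= => /andP[hr _] E.
  have := ou_growth_ge0 theta (_ : 0 <= h - 1); rewrite subr_ge0 => /(_ h1) g0.
  apply: (@le_trans _ _ (expR (theta * r))).
    by rewrite ler_expR ler_wpM2l// ltW.
  by move: E; rewrite subKr mulr1 => <-; rewrite gerBl.
apply: (@le_trans _ _ (expR (- kappa * h) * expR (theta * (h - 1)))); last first.
  by rewrite ler_wpM2l ?expR_ge0.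
rewrite -expRD; apply: le_trans (expR_ge1Dx _).
have : (theta - kappa) * n%:R <= (theta - kappa) * h by rewrite ler_wpM2l// ltW.
by move: en; lra.
Qed.

(** The weight exp (- kappa h) decays faster than the variance grows. *)
Lemma spreading_mean_cvg1 theta kappa e : 0 <= theta -> theta < kappa -> 0 < e ->
  \forall n \near \oo,
    1 - laplace_sqr (expR (- kappa * n.+1%:R) * ou_growth theta n.+1%:R) <= e.
Proof.
move=> t0 tk e0; pose d := (kappa - theta) / 2.
have d0 : 0 < d by rewrite divr_gt0// subr_gt0.
have := nbhs_infty_ger (e^-1 / d ^+ 2); apply: filterS => n.
rewrite ler_pdivrMr ?exprn_gt0// => en.
set h := n.+1%:R; have h0 : 0 < h by rewrite /h.
have hn : n%:R <= h by rewrite /h ler_nat.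
set v := _ * _; have v0 : 0 <= v.
  by rewrite mulr_ge0 ?expR_ge0// ou_growth_ge0// ltW.
have ve : v <= e.
  have W : ou_growth theta h <= h * expR (theta * h).
    have [|r] := MVT h0 (fun r _ => is_derive_ou_growth theta r).
      apply: continuous_subspaceT => r.
      by apply/differentiable_continuous/derivable1_diffP; have [] := is_derive_ou_growth theta r.
    rewrite in_itv/= => /andP[_ rh]; rewrite ou_growth0 !subr0 mulrC => ->.
    by rewrite ler_wpM2l ?(ltW h0)// ler_expR ler_wpM2l// ltW.
  apply: (@le_trans _ _ (expR (- kappa * h) * (h * expR (theta * h)))).
    by rewrite ler_wpM2l ?expR_ge0.
  (* Halving the gap between the rates leaves a square, which beats the factor h. *)
  have -> : expR (- kappa * h) * (h * expR (theta * h)) = h / expR (d * h) ^+ 2.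
    rewrite mulrCA -expRD -expRM_natl -expRN; congr (_ * expR _).
    by rewrite /d; field.
  have dh : d * h <= expR (d * h) by apply: le_trans (expR_ge1Dx _); rewrite lerDr.
  have dh0 : 0 < d * h by rewrite mulr_gt0.
  rewrite ler_pdivrMr ?exprn_gt0 ?expR_gt0//.
  apply: (@le_trans _ _ (e * (d * h) ^+ 2)); last first.
    by rewrite ler_wpM2l ?(ltW e0)// ler_pXn2r// ?nnegrE ?expR_ge0// ltW.
  have : e^-1 <= h * d ^+ 2 by rewrite (le_trans en)// ler_wpM2r ?sqr_ge0.
  rewrite -(@ler_pM2l _ (e * h)) ?mulr_gt0//.
  have -> : e * h * e^-1 = h by field; exact: lt0r_neq0.
  by have -> : e * h * (h * d ^+ 2) = e * (d * h) ^+ 2 by ring.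
have v1 : 0 < 1 + v by rewrite ltr_pwDl.
have lo : 1 - v <= 1 / (1 + v).
  by rewrite ler_pdivlMr//; have := sqr_ge0 v; rewrite expr2; lra.
have hi : 1 / (1 + v) <= laplace_sqr v.
  have v2 : 0 < 1 + 2 * v by lra.
  rewrite div1r /laplace_sqr lef_pV2 ?posrE ?sqrtr_gt0//.
  rewrite -[leRHS]ger0_norm ?(ltW v1)// -sqrtr_sqr ler_sqrt ?sqr_ge0//.
  by have := sqr_ge0 v; rewrite !expr2; lra.
by rewrite lerBlDr -lerBlDl (le_trans _ hi)// (le_trans _ lo)// lerD2l lerN2.
Qed.

End growth_asymptotics.

(** * Concentration of averages *)

Section unit_interval_expectations.
Context (R : realType) d (S : measurableType d) (P : probability S R).
Implicit Types f g : S -> R.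

Lemma probability_integral_cst (c : R) : (\int[P]_w c%:E = c%:E)%E.
Proof.
rewrite integral_cst// -[RHS]mule1; congr (_ * _)%E; exact: probability_setT.
Qed.

Lemma unit_interval_integrable f : measurable_fun setT f ->
  (forall w, 0 <= f w <= 1) -> P.-integrable setT (EFin \o f).
Proof.
move=> mf f01; apply: (@le_integrable _ _ _ P _ measurableT _ (EFin \o cst 1%R)).
- exact/measurable_EFinP.
- by move=> w _ /=; have /andP[f0 f1] := f01 w; rewrite lee_fin normr1 ger0_norm.
- exact: finite_measure_integrable_cst.
Qed.

(** Centred at 0 and, below, at 1: the mean alone controls the mean square deviation
    from an end of the interval. *)
Lemma unit_interval_sqr_le f : measurable_fun setT f ->
  (forall w, 0 <= f w <= 1) ->
  (\int[P]_w ((f w - 0) ^+ 2)%:E <= \int[P]_w (f w)%:E)%E.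
Proof.
move=> mf f01; apply: ge0_le_integral => //.
- by move=> w _; rewrite lee_fin sqr_ge0.
- by apply/measurable_EFinP/measurable_funX/measurable_funB.
- exact/measurable_EFinP.
move=> w _; have /andP[f0 f1] := f01 w.
by rewrite lee_fin subr0 expr2 ler_piMr.
Qed.

Lemma unit_interval_sqr_le1 f (m : R) : measurable_fun setT f ->
  (forall w, 0 <= f w <= 1) -> (\int[P]_w (f w)%:E = m%:E)%E ->
  (\int[P]_w ((f w - 1) ^+ 2)%:E <= (1 - m)%:E)%E.
Proof.
move=> mf f01 fm.
have -> : ((1 - m)%:E = \int[P]_w (1 - f w)%:E)%E.
  under eq_integral do rewrite EFinB.
  rewrite integralB//; last 2 first.
  - exact: finite_measure_integrable_cst.
  - exact: unit_interval_integrable.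
  by rewrite fm probability_integral_cst.
apply: ge0_le_integral => //.
- by move=> w _; rewrite lee_fin sqr_ge0.
- by apply/measurable_EFinP/measurable_funX/measurable_funB.
- by apply/measurable_EFinP/measurable_funB.
move=> w _; have /andP[f0 f1] := f01 w.
rewrite lee_fin -sqrrN opprB expr2 ler_piMr ?subr_ge0//; lra.
Qed.

(** Expanding the square, the n.+1 diagonal terms contribute at most 1 / n.+1, and
    each of the others is at most m' ^+ 2 - m ^+ 2. *)
Lemma average_concentration (n : nat) (f : nat -> S -> R) (m m' : R) :
  (forall i, measurable_fun setT (f i)) -> (forall i w, 0 <= f i w <= 1) ->
  0 <= m ->
  (forall i, m%:E <= \int[P]_w (f i w)%:E)%E ->
  (forall i j, (i < j)%N -> \int[P]_w (f i w * f j w)%:E <= (m' ^+ 2)%:E)%E ->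
  (\int[P]_w ((n.+1%:R^-1 * (\sum_(i < n.+1) f i w) - m) ^+ 2)%:E <=
   (n.+1%:R^-1 + (m' ^+ 2 - m ^+ 2))%:E)%E.
Proof.
move=> mf f01 m0 fm ff.
have if1 i : P.-integrable setT (EFin \o f i) by exact: unit_interval_integrable.
have if2 i j : P.-integrable setT (fun w => (f i w * f j w)%:E).
  apply: (@unit_interval_integrable (fun w => f i w * f j w)).
    exact: measurable_funM.
  move=> w; have /andP[? ?] := f01 i w; have /andP[? ?] := f01 j w.
  by rewrite mulr_ge0// mulr_ile1.
pose I := fun i => \int[P]_w f i w.
pose J := fun i j => \int[P]_w (f i w * f j w).
have IE i : ((I i)%:E = \int[P]_w (f i w)%:E)%E.
  by rewrite /I /Rintegral fineK//; exact: (integrable_fin_num measurableT (if1 i)).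
have JE i j : ((J i j)%:E = \int[P]_w (f i w * f j w)%:E)%E.
  by rewrite /J /Rintegral fineK//; exact: (integrable_fin_num measurableT (if2 i j)).
have gE i j w : ((f i w - m) * (f j w - m))%:E =
   ((f i w * f j w)%:E + ((- m)%:E * (f i w)%:E + ((- m)%:E * (f j w)%:E + (m ^+ 2)%:E)))%E.
  by rewrite -!EFinM -!EFinD; congr EFin; ring.
have im (c : R) i : P.-integrable setT (fun w => c%:E * (f i w)%:E)%E.
  by apply: (@integrableZl _ _ _ P _ measurableT c _ (if1 i)).
have ic (c : R) : P.-integrable setT (cst c%:E) by exact: finite_measure_integrable_cst.
have i3 j : P.-integrable setT (fun w => (- m)%:E * (f j w)%:E + (m ^+ 2)%:E)%E.
  exact: (integrableD measurableT (im _ j) (ic _)).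
have i4 i j : P.-integrable setT
    (fun w => (- m)%:E * (f i w)%:E + ((- m)%:E * (f j w)%:E + (m ^+ 2)%:E))%E.
  exact: (integrableD measurableT (im _ i) (i3 j)).
have ig i j : P.-integrable setT (fun w => ((f i w - m) * (f j w - m))%:E).
  rewrite (_ : (fun _ => _) = (fun w => (f i w * f j w)%:E +
    ((- m)%:E * (f i w)%:E + ((- m)%:E * (f j w)%:E + (m ^+ 2)%:E)))%E);
    last exact/funext/gE.
  exact: (integrableD measurableT (if2 i j) (i4 i j)).
have gI i j : (\int[P]_w ((f i w - m) * (f j w - m))%:E =
    (J i j - m * I i - m * I j + m ^+ 2)%:E)%E.
  rewrite (eq_integral _ _ (fun w _ => gE i j w)) (integralD measurableT (if2 i j) (i4 i j)).
  rewrite (integralD measurableT (im _ i) (i3 j)).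
  rewrite (integralD measurableT (im _ j) (ic _)).
  rewrite (integralZl measurableT (if1 i)) (integralZl measurableT (if1 j)).
  rewrite [X in (_ + (_ + (_ + X)))%E]probability_integral_cst.
  by rewrite -JE -!IE -!EFinM -!EFinD; congr EFin; ring.
have g1 i : (\int[P]_w ((f i w - m) * (f i w - m))%:E <= (1 + (m' ^+ 2 - m ^+ 2))%:E)%E.
  rewrite gI lee_fin.
  have : J i i <= 1.
    rewrite -lee_fin JE -[leRHS]probability_integral_cst.
    apply: ge0_le_integral => //.
    - by move=> w _; rewrite lee_fin -expr2 sqr_ge0.
    - by have /integrableP[] := if2 i i.
    by move=> w _; have /andP[? ?] := f01 i w; rewrite lee_fin mulr_ile1.
  have := fm i; rewrite -IE lee_fin => mi.
  have : m * m <= m * I i by rewrite ler_wpM2l.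
  have := sqr_ge0 m'; rewrite !expr2; lra.
have g2 i j : (i < j)%N ->
  (\int[P]_w ((f i w - m) * (f j w - m))%:E <= (m' ^+ 2 - m ^+ 2)%:E)%E.
  move=> ij; rewrite gI lee_fin.
  have := ff i j ij; rewrite -JE lee_fin.
  have := fm i; rewrite -IE lee_fin => mi.
  have := fm j; rewrite -IE lee_fin => mj.
  have : m * m <= m * I i by rewrite ler_wpM2l.
  have : m * m <= m * I j by rewrite ler_wpM2l.
  rewrite !expr2; lra.
have g3 i j : i != j ->
  (\int[P]_w ((f i w - m) * (f j w - m))%:E <= (m' ^+ 2 - m ^+ 2)%:E)%E.
  rewrite neq_ltn => /orP[|ji]; first exact: g2.
  by under eq_integral do rewrite mulrC; exact: g2.
set N := n.+1%:R.
have expand w : ((N^-1 * (\sum_(i < n.+1) f i w) - m) ^+ 2)%:E =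
    ((N ^- 2)%:E * \sum_(i < n.+1) \sum_(j < n.+1) ((f i w - m) * (f j w - m))%:E)%E.
  have N0 : N != 0 by rewrite /N.
  have -> : N^-1 * (\sum_(i < n.+1) f i w) - m = N^-1 * \sum_(i < n.+1) (f i w - m).
    rewrite sumrB sumr_const card_ord -[m *+ _]mulr_natl mulrBr mulrA mulVf//.
    by rewrite mul1r.
  rewrite [X in (_ * X)%E](_ : _ =
    (\sum_(i < n.+1) \sum_(j < n.+1) (f i w - m) * (f j w - m))%:E); last first.
    by rewrite -sumEFin; apply: eq_bigr => i _; rewrite sumEFin.
  rewrite -EFinM; congr EFin.
  rewrite exprMn exprVn; congr (_ * _); rewrite expr2 mulr_suml.
  by apply: eq_bigr => i _; rewrite mulr_sumr.
rewrite (eq_integral _ _ (fun w _ => expand w)) integralZl//; last first.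
  by apply: integrable_sum => // i _; apply: integrable_sum.
rewrite integral_sum//; last by move=> i; apply: integrable_sum.
under eq_bigr do rewrite integral_sum//.
have N0 : 0 < N by rewrite /N.
have row (i : 'I_n.+1) : (\sum_(j < n.+1) \int[P]_w ((f i w - m) * (f j w - m))%:E <=
    (1 + N * (m' ^+ 2 - m ^+ 2))%:E)%E.
  have -> : 1 + N * (m' ^+ 2 - m ^+ 2) =
      \sum_(j < n.+1) ((j == i)%:R + (m' ^+ 2 - m ^+ 2)).
    rewrite big_split/= sumr_const card_ord -[_ *+ n.+1]mulr_natl; congr (_ + _).
    by rewrite (bigD1 i)//= eqxx big1 ?addr0// => j /negbTE ->.
  rewrite -sumEFin; apply: lee_sum => j _; have [->|ji] := eqVneq j i; first exact: g1.
  by rewrite add0r; apply: g3; rewrite eq_sym.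
apply: (@le_trans _ _ ((N ^- 2)%:E * \sum_(i < n.+1) (1 + N * (m' ^+ 2 - m ^+ 2))%:E)%E).
  by rewrite lee_wpmul2l ?lee_fin ?invr_ge0 ?sqr_ge0//; apply: lee_sum => i _; exact: row.
rewrite sumEFin -EFinM lee_fin sumr_const card_ord -[X in _ * X]mulr_natl -/N.
by rewrite le_eqVlt; apply/orP; left; apply/eqP; field; exact: lt0r_neq0.
Qed.

End unit_interval_expectations.

(** * Singularity from concentration *)

Lemma singular_sym d (S : measurableType d) (R : realType)
    (P1 P2 : probability S R) : singular P1 P2 -> singular P2 P1.
Proof.
by move=> [S1 [S2 [m1 m2 S0 p1 p2]]]; exists S2, S1; split; rewrite 1?setIC.
Qed.

Section singular.
Local Open Scope ereal_scope.
Context (R : realType) d (S : measurableType d).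

(** Chebyshev's inequality makes the probabilities of deviation summable. *)
Lemma limsup_deviation_null (P1 : probability S R) (F : nat -> S -> R) (a r : R) :
  (0 < r)%R -> (forall n, measurable_fun setT (F n)) ->
  (forall n, \int[P1]_x ((F n x - a) ^+ 2)%:E <= (r ^+ 2 / (2 ^ n.+1)%:R)%:E) ->
  P1 (lim_sup_set (fun n => [set x | (r <= `|F n x - a|)%R])) = 0.
Proof.
move=> r0 mF dev; have mFa n : measurable_fun setT (fun x => `|F n x - a|)%R.
  by apply: measurableT_comp => //; exact: measurable_funB.
have mA n : measurable [set x | (r <= `|F n x - a|)%R].
  rewrite -[X in measurable X]setTI; apply: measurable_fun_le => //.
apply: lim_sup_set_cvg0 => //.
apply: (@le_lt_trans _ _ 1); last exact: ltry.
apply: le_trans (epsilon_trick0 _ ler01).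
apply: lee_nneseries => // n _; rewrite div1r.
rewrite -(@lee_pmul2l _ (r ^+ 2)%:E)// ?lte_fin ?exprn_gt0//.
rewrite -EFinM; apply: le_trans (dev n).
set A := [set x | _].
rewrite [X in _ * X](_ : _ = \int[P1]_x (\1_A x)%:E); last first.
  by rewrite integral_indic ?setIT//; exact: mA.
rewrite -ge0_integralZl//=; last 2 first.
- apply/measurable_EFinP; exact: (measurable_indic (mA n)).
- by rewrite lee_fin sqr_ge0.
apply: ge0_le_integral => //=.
- by move=> x _; rewrite -EFinM lee_fin mulr_ge0 ?sqr_ge0.
- apply: emeasurable_funM => //; apply/measurable_EFinP.
  exact: (measurable_indic (mA n)).
- by apply/measurable_EFinP/measurable_funX/measurable_funB.
move=> x _; rewrite -EFinM lee_fin indicE.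
have [|_] := boolP (x \in A); rewrite ?mulr0 ?sqr_ge0// inE/= => rx.
by rewrite mulr1 -[leRHS]real_normK ?num_real// ler_pXn2r// ?nnegrE ltW.
Qed.

(** Along a subsequence chosen for summability, F is eventually within r of a
    almost surely for P1, and within r of b for P2, where 2 r = |a - b|; the two events
    are disjoint. *)
Lemma singular_of_concentration (P1 P2 : probability S R) (F : nat -> S -> R)
    (a b : R) : a != b -> (forall n, measurable_fun setT (F n)) ->
  (forall e : R, (0 < e)%R -> exists n,
     \int[P1]_x ((F n x - a) ^+ 2)%:E <= e%:E /\
     \int[P2]_x ((F n x - b) ^+ 2)%:E <= e%:E) ->
  singular P1 P2.
Proof.
move=> ab mF conc; pose r := (`|a - b| / 2)%R.
have r0 : (0 < r)%R by rewrite divr_gt0// normr_gt0 subr_eq0.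
have e0 k : (0 < r ^+ 2 / (2 ^ k.+1)%:R)%R.
  by rewrite divr_gt0 ?exprn_gt0// ltr0n expn_gt0.
have [f fP] := choice (fun k => conc _ (e0 k)).
pose G k := F (f k).
have mG k : measurable_fun setT (G k) by exact: mF.
pose A c (k : nat) := [set x | (r <= `|G k x - c|)%R].
have mA c k : measurable (A c k).
  rewrite -[X in measurable X]setTI; apply: measurable_fun_le => //.
  by apply: measurableT_comp => //; exact: measurable_funB.
have mL c : measurable (lim_sup_set (A c)).
  by apply: bigcap_measurable => // k _; apply: bigcup_measurable => j _; exact: mA.
have L1 : P1 (lim_sup_set (A a)) = 0.
  by apply: limsup_deviation_null => // n; have [] := fP n.
have L2 : P2 (lim_sup_set (A b)) = 0.
  by apply: limsup_deviation_null => // n; have [] := fP n.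
exists (~` lim_sup_set (A a)), (~` lim_sup_set (A b)); split.
- exact: measurableC.
- exact: measurableC.
- rewrite -subset0 => x [/=]; rewrite /lim_sup_set => xa xb.
  move/existsNP : xa => [m /not_implyP[_ xm]].
  move/existsNP : xb => [n /not_implyP[_ xn]].
  pose k := maxn m n.
  have ka : (`|G k x - a| < r)%R.
    rewrite ltNge; apply/negP => kA; apply: xm; exists k => //=.
    exact: leq_maxl.
  have kb : (`|G k x - b| < r)%R.
    rewrite ltNge; apply/negP => kA; apply: xn; exists k => //=.
    exact: leq_maxr.
  have : (`|a - b| < r + r)%R.
    rewrite (_ : a - b = (G k x - b) - (G k x - a))%R; last by ring.
    by rewrite (le_lt_trans (ler_normB _ _))// ltrD.
  by rewrite /r -splitr ltxx.
- by rewrite probability_setC// L1 sube0.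
- by rewrite probability_setC// L2 sube0.
Qed.

End singular.

Lemma law_singular (R : realType) d (Omega : measurableType d)
    (P : probability Omega R) (T : R) (X Y : continuous_process Omega T)
    (F : nat -> path_space T -> R) (a b : R) :
  a != b -> (forall n, measurable_fun setT (F n)) ->
  (forall e : R, 0 < e -> exists n,
     (\int[P]_w ((F n (X w) - a) ^+ 2)%:E <= e%:E)%E /\
     (\int[P]_w ((F n (Y w) - b) ^+ 2)%:E <= e%:E)%E) ->
  singular (law P X) (law P Y).
Proof.
move=> ab mF conc; apply: (singular_of_concentration ab mF) => e e0.
have mFc n c : measurable_fun setT (fun h => ((F n h - c) ^+ 2)%:E).
  by apply/measurable_EFinP/measurable_funX/measurable_funB.
have sqr0 n c h : (0 <= ((F n h - c) ^+ 2)%:E)%E by rewrite lee_fin sqr_ge0.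
have [n [nX nY]] := conc e e0; exists n.
by split; rewrite /law ge0_integral_distribution.
Qed.

(** * Separating two parameters *)

Section separation.
Context (R : realType) (d : measure_display) (Omega : measurableType d)
  (P : probability Omega R) (B : R -> {RV P >-> R}) (T : R).
Hypothesis T0 : 0 < T.
Hypothesis wB : wiener_process B.

Definition average_obs (n : nat) (h : path_space T) : R :=
  n.+1%:R^-1 * \sum_(i < n.+1) obs T0 1 (n.+1%:R * i.+1%:R) h.

(** The spacing n.+1 between the log-times grows with n, so that the means and
    the pairwise correlations all approach their limits uniformly. *)
Lemma average_obs_cvg alpha (X : continuous_process Omega T) (e : R) :
  strong_solution B alpha X -> 0 < e -> \forall n \near \oo,
    (\int[P]_w ((average_obs n (X w) - stationary_mean (1 - 2 * alpha)) ^+ 2)%:E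
       <= e%:E)%E.
Proof.
move=> sX e0; have e2 : 0 < e / 2 by rewrite divr_gt0.
have := near_infty_natSinv_lt (PosNum e2).
have := stationary_mean_cvg (1 - 2 * alpha) e2.
apply: filterS2 => n; set th := 1 - 2 * alpha; set m := stationary_mean th => mn /= ne.
pose f (i : nat) w := obs T0 1 (n.+1%:R * i.+1%:R) (X w).
have n0 : 0 < n.+1%:R :> R by [].
have W0 h : 0 <= h -> 0 <= ou_growth th h by exact: ou_growth_ge0.
have bnd (h : R) : n.+1%:R <= h -> laplace_sqr (1 * ou_growth th h) <=
    laplace_sqr (ou_growth th n.+1%:R).
  move=> nh; rewrite mul1r; apply: laplace_sqr_le; first exact: W0.
  exact: ou_growth_le.
have le_n (i : nat) : n.+1%:R <= n.+1%:R * i.+1%:R :> R by rewrite ler_peMr// ler1n.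
apply: (@le_trans _ _ (n.+1%:R^-1 +
    (laplace_sqr (ou_growth th n.+1%:R) ^+ 2 - m ^+ 2))%:E); last first.
  have {}ne : n.+1%:R^-1 < e / 2 := ne.
  by rewrite lee_fin [leRHS]splitr lerD ?(ltW ne)// lerBlDl.
apply: (@average_concentration _ _ _ P n f m).
- by move=> i; exact: measurable_obs_process.
- by move=> i w; rewrite obs_ge0 obs_le1.
- exact: stationary_mean_ge0.
- move=> i; rewrite (mean_obs T0 wB sX)// ?mulr_gt0// lee_fin mul1r.
  by apply: stationary_mean_le; rewrite mulr_ge0.
move=> i j ij; apply: (le_trans (corr_obs T0 wB sX _ _ _ _)) => //.
  by rewrite ltr_pM2l// ltr_nat.
rewrite lee_fin expr2 ler_pM ?laplace_sqr_ge0 ?bnd//.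
rewrite -mulrBr ler_peMr// -natrB; last by rewrite ltnW.
by rewrite ler1n subSS subn_gt0.
Qed.

(** The limits of the averages differ as soon as one of the parameters exceeds 1/2. *)
Lemma singular_ergodic alpha beta (X Y : continuous_process Omega T) :
  strong_solution B alpha X -> strong_solution B beta Y -> alpha <> beta ->
  1 - 2 * alpha < 0 -> singular (law P X) (law P Y).
Proof.
move=> sX sY ab neg.
apply: (@law_singular _ _ _ P _ X Y average_obs
  (stationary_mean (1 - 2 * alpha)) (stationary_mean (1 - 2 * beta))).
- by apply: stationary_mean_neq => //; apply/eqP => E; apply: ab; lra.
- move=> n; apply: measurable_funM => //; apply: measurable_sum => i.
  exact: measurable_obs.
move=> e e0; have [n ?] := filter_ex (filterI (average_obs_cvg sX e0) (average_obs_cvg sY e0)).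
by exists n.
Qed.

(** The rate kappa = 1 - alpha - beta is the midpoint of the growth rates
    1 - 2 alpha and 1 - 2 beta of the two variances. *)
Lemma singular_spreading alpha beta (X Y : continuous_process Omega T) :
  strong_solution B alpha X -> strong_solution B beta Y ->
  alpha < beta -> 0 <= 1 - 2 * beta -> singular (law P X) (law P Y).
Proof.
move=> sX sY ab b0; pose kappa := 1 - alpha - beta.
pose F n := obs T0 (expR (- kappa * n.+1%:R)) n.+1%:R.
have k0 n : 0 <= expR (- kappa * n.+1%:R) by exact: expR_ge0.
have n0 n : 0 < n.+1%:R :> R by [].
have F01 (Z : continuous_process Omega T) n w : 0 <= F n (Z w) <= 1.
  by rewrite obs_ge0 obs_le1.
have mF (Z : continuous_process Omega T) n : measurable_fun setT (fun w => F n (Z w)).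
  exact: measurable_obs_process.
apply: (@law_singular _ _ _ P _ X Y F 0 1).
- by rewrite eq_sym oner_eq0.
- by move=> n; exact: measurable_obs.
move=> e e0.
have a0 : 0 <= 1 - 2 * alpha by lra.
have ka : kappa < 1 - 2 * alpha by rewrite /kappa; lra.
have kb : 1 - 2 * beta < kappa by rewrite /kappa; lra.
have [n [na nb]] := filter_ex (filterI (spreading_mean_cvg0 a0 ka e0)
  (spreading_mean_cvg1 b0 kb e0)).
exists n; split.
  apply: le_trans (unit_interval_sqr_le P (mF X n) (F01 X n)) _.
  by rewrite (mean_obs T0 wB sX) ?lee_fin.
apply: le_trans (unit_interval_sqr_le1 (mF Y n) (F01 Y n) (mean_obs T0 wB sY (k0 n) (n0 n))) _.
by rewrite lee_fin.
Qed.

End separation.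

Theorem theorem4p1 (R : realType) (d : measure_display)
    (Omega : measurableType d) (P : probability Omega R)
    (B : R -> {RV P >-> R}) (T : R) (alpha beta : R)
    (Xalpha Xbeta : continuous_process Omega T) :
  0 < T ->
  wiener_process B ->
  strong_solution B alpha Xalpha ->
  strong_solution B beta Xbeta ->
  alpha <> beta ->
  singular (law P Xalpha) (law P Xbeta).
Proof.
move=> T0 wB sXa sXb ab.
have [a0|a0] := ltP (1 - 2 * alpha) 0; first exact: (singular_ergodic T0 wB sXa sXb).
have [b0|b0] := ltP (1 - 2 * beta) 0.
  by apply/singular_sym/(singular_ergodic T0 wB sXb sXa) => // E; exact: ab.
have [ltab|ltba|//] := ltgtP alpha beta.
  exact: (singular_spreading T0 wB sXa sXb).
exact/singular_sym/(singular_spreading T0 wB sXb sXa).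
Qed.
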